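(* Let $\{e_j\}_{j\in J}\subset L^2(Z)$ be a countable subset and let $E:=\overline{\mathrm{span}}\{e_j\cdot b : j\in J,\ b\in C^*_r(\mathcal{H})\}\subset L^2(Z)$ be the closed right $C^*_r(\mathcal{H})$-submodule generated by $\{e_j\}_{j\in J}$. The following are equivalent: (1) $\{e_j\}_{j\in J}$ is a right $C^*$-module frame of $E$. (2) For every $\xi\in E$ the map $j\mapsto (e_j\mid \xi)_{\mathcal{H}}$ is an element of $\ell^2(J,C^*_r(\mathcal{H}))$, and for all $x\in\mathcal{H}^{(0)}$ the set $\{(e_j)_x^\alpha\}_{j\in J,\ \alpha\in r^{-1}(x)}$ is a normalised tight frame for $\overline{E_x}\subset L^2(Z_x)$.
   Context: Setting. All groupoids are second countable, locally compact and Hausdorff, with range and source maps $r,s$. $\mathcal{G},\mathcal{H}$ are groupoids; $\mathcal{H}$ is étale with compact unit space $\mathcal{H}^{(0)}$; $\mathcal{G}$ has a Haar system $\{\nu^u\}_{u\in\mathcal{G}^{(0)}}$. $Z$ is a $\mathcal{G}$–$\mathcal{H}$ groupoid equivalence: a (locally compact, Hausdorff) space with a left $\mathcal{G}$-action with open surjective anchor map $\rho:Z\to\mathcal{G}^{(0)}$ and a right $\mathcal{H}$-action with open surjective anchor map $\phi:Z\to\mathcal{H}^{(0)}$, the actions commute, $\rho(z\eta)=\rho(z)$, $\phi(\gamma z)=\phi(z)$, and the maps $(\gamma,z)\mapsto(\gamma z,z)$ into $Z\times_{\mathcal{H}^{(0)}}Z$ and $(z,\eta)\mapsto(z,z\eta)$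 into $Z\times_{\mathcal{G}^{(0)}}Z$ are homeomorphisms. $C_c(Z)$ is a bimodule over the convolution algebras $C_c(\mathcal{G})$, $C_c(\mathcal{H})$ via $(f\cdot\xi)(z)=\int_{\mathcal{G}} f(\gamma)\xi(\gamma^{-1}z)\,d\nu^{\rho(z)}(\gamma)$, $(\xi\cdot g)(z)=\sum_{\eta\in r^{-1}(\phi(z))}\xi(z\eta)g(\eta^{-1})$, with right inner product $(\xi_1\mid\xi_2)_{\mathcal{H}}(\eta)=\int_{\mathcal{G}}\overline{\xi_1(\gamma^{-1}z)}\,\xi_2(\gamma^{-1}z\eta)\,d\nu^{\rho(z)}(\gamma)$ for any $z$ with $\phi(z)=r(\eta)$. It completes to a Morita equivalence bimodule between $C^*_r(\mathcal{G})$ and $C^*_r(\mathcal{H})$ denoted $L^2(Z)$. Frames. For a right $C^*$-module $E$, $\Theta^R_{e_1,e_2}(e)=e_1\cdot(e_2\mid e)$; a countable set $\{e_j\}\subset E$ is a (right) $C^*$-module frame if $\sum_j\Theta^R_{e_j,e_j}$ converges strictly to $\mathrm{Id}_E$. A normalised tight frame of a Hilbert space $\mathfrak{h}$ is a family $\{g_i\}$ with $\sum_i|\langle g_i,\psi\rangle|^2=\|\psi\|^2$ for all $\psi\in\mathfrak{h}$. For a $C^*$-algebra $B$, $\ell^2(J,B)=\{f:J\to B:\ \sum_{j}f(j)^*f(j)\text{ converges in } B\}$. Localisation. For $x\in\mathcal{H}^{(0)}$, $\omega_x$ is the state of $C^*_r(\mathcal{H})$ with $\omega_x(f)=f(x)$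 for $f\in C_c(\mathcal{H})$; $\mathfrak{h}_x$ is the Hilbert space completion of $L^2(Z)$ in $\langle e_1,e_2\rangle_x=\omega_x((e_1\mid e_2)_{\mathcal{H}})$. It is $L^2(Z_x)$ with $Z_x=\phi^{-1}(x)$ and measure $f\mapsto\int_{\mathcal{G}}f(\gamma^{-1}z)\,d\nu^{\rho(z)}(\gamma)$, independent of $z\in Z_x$. $e_x$ is the image of $e\in L^2(Z)$ in $\mathfrak{h}_x$, and $E_x=\{e_x:e\in E\}$. For $\alpha\in r^{-1}(x)\subset\mathcal{H}$ the translate $e_x^\alpha\in L^2(Z_x)$ is $e_x^\alpha(y)=e(y\alpha)$, $y\in Z_x$ (the localisation of $e$ at $s(\alpha)$ composed with $y\mapsto y\alpha$, $Z_x\to Z_{s(\alpha)}$). *)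

(* Defs.v *)
From HB Require Import structures.
From mathcomp Require Import all_boot all_order all_algebra finmap complex.
From mathcomp Require Import all_classical all_reals all_analysis.
From mathcomp Require showcase.summability.
Set Implicit Arguments.
Unset Strict Implicit.
Unset Printing Implicit Defensive.
Import Order.TTheory GRing.Theory Num.Theory numFieldNormedType.Exports.
Local Open Scope classical_set_scope.
Local Open Scope ring_scope.

(* Throughout, R[i] is the field of complex numbers over the realType R; its
   topology is that of the normed module R[i]^o. *)

Definition homeo_on (X Y : topologicalType) (A : set X) (B : set Y)
    (f : X -> Y) : Prop :=
  set_bij A B f /\ {within A, continuous f} /\
  exists g : Y -> X, (forall a, A a -> g (f a) = a) /\ {within B, continuous g}.

Definition open_map (X Y : topologicalType) (f : X -> Y) : Prop :=
  forall U : set X, open U -> open (f @` U).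

Definition local_homeo (X Y : topologicalType) (f : X -> Y) : Prop :=
  forall x, exists U : set X,
    [/\ open U, U x, open (f @` U) & homeo_on U (f @` U) f].

Definition Cc (R : realType) (T : topologicalType) (f : T -> R[i]) : Prop :=
  continuous (f : T -> R[i]^o) /\ compact (closure [set t | f t != 0]).

Notation borel T := (g_sigma_algebraType (@open T)).

Definition abs2 (R : realType) (z : R[i]) : R :=
  complex.Re z ^+ 2 + complex.Im z ^+ 2.

Definition Cintegral d (T : measurableType d) (R : realType)
    (mu : {measure set T -> \bar R}) (D : set T) (f : T -> R[i]) : R[i] :=
  (Rintegral mu D (fun t => complex.Re (f t)) +i*
   Rintegral mu D (fun t => complex.Im (f t)))%C.

(* Square-integrable functions on D; values off D are irrelevant. *)
Definition L2fun d (T : measurableType d) (R : realType)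
    (mu : {measure set T -> \bar R}) (D : set T) (f : T -> R[i]) : Prop :=
  [/\ measurable_fun D (fun t => complex.Re (f t)),
      measurable_fun D (fun t => complex.Im (f t)) &
      (\int[mu]_(t in D) (abs2 (f t))%:E < +oo)%E].

Record hilbert_space (R : realType) := HilbertSpace {
  hilbert_sort :> completeNormedModType R[i];
  hdot : hilbert_sort -> hilbert_sort -> R[i];
  hdot_linear : forall u a v w, hdot u (a *: v + w) = a * hdot u v + hdot u w;
  hdot_conj : forall u v, hdot v u = (hdot u v)^*;
  hdot_norm : forall v, `|v| ^+ 2 = hdot v v
}.

Record cstar_algebra (R : realType) := CstarAlgebra {
  cstar_sort :> completeNormedModType R[i];
  cmul : cstar_sort -> cstar_sort -> cstar_sort;
  cadj : cstar_sort -> cstar_sort;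
  cmulA : forall a b c, cmul a (cmul b c) = cmul (cmul a b) c;
  cmul_linearl : forall c k a b,
    cmul (k *: a + b) c = k *: cmul a c + cmul b c;
  cmul_linearr : forall c k a b,
    cmul c (k *: a + b) = k *: cmul c a + cmul c b;
  cadj_antilinear : forall k a b, cadj (k *: a + b) = k^* *: cadj a + cadj b;
  cadjK : forall a, cadj (cadj a) = a;
  cadjM : forall a b, cadj (cmul a b) = cmul (cadj b) (cadj a);
  cmul_norm : forall a b, `|cmul a b| <= `|a| * `|b|;
  cstar_norm : forall a, `|cmul (cadj a) a| = `|a| ^+ 2
}.

Record cstar_module (R : realType) (B : cstar_algebra R) := CstarModule {
  module_sort :> completeNormedModType R[i];
  mact : module_sort -> B -> module_sort;
  mdot : module_sort -> module_sort -> B;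
  mact_linearl : forall b k u v,
    mact (k *: u + v) b = k *: mact u b + mact v b;
  mact_linearr : forall u k a b,
    mact u (k *: a + b) = k *: mact u a + mact u b;
  mactA : forall u a b, mact u (cmul a b) = mact (mact u a) b;
  mdot_linear : forall u k v w, mdot u (k *: v + w) = k *: mdot u v + mdot u w;
  mdot_act : forall u v b, mdot u (mact v b) = cmul (mdot u v) b;
  mdot_adj : forall u v, mdot v u = cadj (mdot u v);
  mdot_pos : forall u, exists c, mdot u u = cmul (cadj c) c;
  mdot_norm : forall u, `|u| ^+ 2 = `|mdot u u|
}.

Record is_state (R : realType) (B : cstar_algebra R) (w : B -> R[i]) : Prop := {
  state_linear : forall k a b, w (k *: a + b) = k * w a + w b;
  state_pos : forall a, 0 <= w (cmul (cadj a) a);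
  state_le : forall a, `|w a| <= `|a|;
  state_norm : forall eps : R[i], 0 < eps ->
    exists2 a, `|a| <= 1 & 1 - eps < `|w a|
}.

(* A Hilbert space realising L^2(D, mu): cls sends a square-integrable function
   to its class. *)
Record is_L2 d (T : measurableType d) (R : realType)
    (mu : {measure set T -> \bar R}) (D : set T)
    (h : hilbert_space R) (cls : (T -> R[i]) -> h) : Prop := {
  L2_linear : forall a f g, L2fun mu D f -> L2fun mu D g ->
    cls (fun t => a * f t + g t) = a *: cls f + cls g;
  L2_dot : forall f g, L2fun mu D f -> L2fun mu D g ->
    hdot (cls f) (cls g) = Cintegral mu D (fun t => (f t)^* * g t);
  L2_surj : forall v, exists2 f, L2fun mu D f & cls f = v
}.

(* Infinite sums in Banach spaces are limits along the net of finite subsets of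
   the index set. *)

Definition lin_span (K : pzRingType) (V : lmodType K) (S : set V) : set V :=
  [set v | exists (n : nat) (c : 'I_n -> K) (w : 'I_n -> V),
     (forall i, S (w i)) /\ v = \sum_(i < n) c i *: w i].

Section Frames.
Context (R : realType) (B : cstar_algebra R) (V : cstar_module B).
Implicit Types (E : set V) (J : choiceType).

Definition generated_submodule J (e : J -> V) : set V :=
  closure (lin_span [set v | exists (j : J) (b : B), v = mact (e j) b]).

Definition theta (e1 e2 e : V) : V := mact e1 (mdot e2 e).

(* The compact operators of a closed submodule E: operators in the norm closure
   of the span of the theta a b with a, b in E (scalars are absorbed in a). *)
Definition compact_op E (K : V -> V) : Prop :=
  (forall v, E v -> E (K v)) /\
  forall eps : R[i], 0 < eps ->
    exists (n : nat) (a b : 'I_n -> V),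
      (forall i, E (a i) /\ E (b i)) /\
      forall v, E v -> `|K v - \sum_(i < n) theta (a i) (b i) v| <= eps * `|v|.

(* Convergence in the strict topology of End*(E) = M(K(E)): T_i K and K T_i
   converge in operator norm for every K in K(E). *)
Definition strict_cvg I (F : set_system I) E (T : I -> V -> V) (T0 : V -> V) :=
  forall K, compact_op E K -> forall eps : R[i], 0 < eps ->
    \forall i \near F, forall v, E v ->
      `|T i (K v) - T0 (K v)| <= eps * `|v| /\
      `|K (T i v) - K (T0 v)| <= eps * `|v|.

Definition is_frame J E (e : J -> V) : Prop :=
  (forall j, E (e j)) /\
  strict_cvg (@summability.totally J) E
    (fun A v => summability.partial_sum (fun j => theta (e j) (e j) v) A)
    idfun.

Definition in_ell2 J (f : J -> B) : Prop :=
  cvg (summability.partial_sum (fun j => cmul (cadj (f j)) (f j))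
         @ summability.totally).

End Frames.

Definition tight_frame (R : realType) (h : hilbert_space R) (W : set h)
    (I : choiceType) (D : set I) (g : I -> h) : Prop :=
  (forall i, D i -> W (g i)) /\
  forall psi, W psi ->
    (\esum_(i in D) (abs2 (hdot (g i) psi))%:E =
     (complex.Re (`|psi| ^+ 2))%:E)%E.

(* The partial operations of groupoids and of their actions are total functions
   whose values are constrained on the domain of composability only.  The space
   of units is a separate type G0, embedded in G by unt. *)

Record groupoid (G0 G : topologicalType) := Groupoid {
  rng : G -> G0;
  src : G -> G0;
  unt : G0 -> G;
  inv : G -> G;
  mul : G -> G -> G;
  rng_unt : forall u, rng (unt u) = u;
  src_unt : forall u, src (unt u) = u;
  rng_inv : forall a, rng (inv a) = src a;
  src_inv : forall a, src (inv a) = rng a;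
  rng_mul : forall a b, src a = rng b -> rng (mul a b) = rng a;
  src_mul : forall a b, src a = rng b -> src (mul a b) = src b;
  mul_assoc : forall a b c, src a = rng b -> src b = rng c ->
    mul a (mul b c) = mul (mul a b) c;
  mul_untl : forall a, mul (unt (rng a)) a = a;
  mul_untr : forall a, mul a (unt (src a)) = a;
  mul_inv : forall a, mul a (inv a) = unt (rng a);
  inv_mul : forall a, mul (inv a) a = unt (src a);
  rng_cont : continuous rng;
  src_cont : continuous src;
  unt_cont : continuous unt;
  inv_cont : continuous inv;
  mul_cont : {within [set p : G * G | src p.1 = rng p.2],
                continuous (fun p => mul p.1 p.2)};
  groupoid_lc : locally_compact [set: G];
  groupoid_hausdorff : hausdorff_space G;
  groupoid_sc : @second_countable G
}.

Definition etale (G0 G : topologicalType) (GG : groupoid G0 G) : Prop :=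
  local_homeo (rng GG).

Record haar_system (R : realType) (G0 : topologicalType) (G : ptopologicalType)
    (GG : groupoid G0 G) (nu : G0 -> {measure set (borel G) -> \bar R}) : Prop := {
  haar_radon : forall u (K : set G), compact K -> (nu u K < +oo)%E;
  haar_fibre : forall u, nu u [set a | rng GG a <> u] = 0%E;
  haar_full : forall a (U : set G), open U -> U a -> (0 < nu (rng GG a) U)%E;
  haar_cont : forall f : G -> R[i], Cc f ->
    continuous (fun u => Cintegral (nu u) setT f : R[i]^o);
  haar_left : forall (f : G -> R[i]) a, Cc f ->
    Cintegral (nu (src GG a)) [set b | rng GG b = src GG a]
      (fun b => f (mul GG a b)) =
    Cintegral (nu (rng GG a)) [set b | rng GG b = rng GG a] f
}.

Record left_action (G0 G : topologicalType) (GG : groupoid G0 G)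
    (Z : topologicalType) := LeftAction {
  lanchor : Z -> G0;
  lact : G -> Z -> Z;
  lanchor_act : forall a z, src GG a = lanchor z ->
    lanchor (lact a z) = rng GG a;
  lact_unt : forall z, lact (unt GG (lanchor z)) z = z;
  lact_mul : forall a b z, src GG a = rng GG b -> src GG b = lanchor z ->
    lact (mul GG a b) z = lact a (lact b z);
  lanchor_cont : continuous lanchor;
  lact_cont : {within [set p : G * Z | src GG p.1 = lanchor p.2],
                 continuous (fun p => lact p.1 p.2)}
}.

Record right_action (H0 H : topologicalType) (HH : groupoid H0 H)
    (Z : topologicalType) := RightAction {
  ranchor : Z -> H0;
  ract : Z -> H -> Z;
  ranchor_act : forall z a, ranchor z = rng HH a ->
    ranchor (ract z a) = src HH a;
  ract_unt : forall z, ract z (unt HH (ranchor z)) = z;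
  ract_mul : forall z a b, ranchor z = rng HH a -> src HH a = rng HH b ->
    ract z (mul HH a b) = ract (ract z a) b;
  ranchor_cont : continuous ranchor;
  ract_cont : {within [set p : Z * H | ranchor p.1 = rng HH p.2],
                 continuous (fun p => ract p.1 p.2)}
}.

Record equivalence (G0 G H0 H : topologicalType) (GG : groupoid G0 G)
    (HH : groupoid H0 H) (Z : topologicalType) := Equivalence {
  eq_left :> left_action GG Z;
  eq_right :> right_action HH Z;
  eq_lc : locally_compact [set: Z];
  eq_hausdorff : hausdorff_space Z;
  eq_lopen : open_map (lanchor eq_left);
  eq_lsurj : forall u, exists z, lanchor eq_left z = u;
  eq_ropen : open_map (ranchor eq_right);
  eq_rsurj : forall x, exists z, ranchor eq_right z = x;
  eq_lanchor : forall z a, ranchor eq_right z = rng HH a ->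
    lanchor eq_left (ract eq_right z a) = lanchor eq_left z;
  eq_ranchor : forall g z, src GG g = lanchor eq_left z ->
    ranchor eq_right (lact eq_left g z) = ranchor eq_right z;
  eq_commute : forall g z a,
    src GG g = lanchor eq_left z -> ranchor eq_right z = rng HH a ->
    lact eq_left g (ract eq_right z a) = ract eq_right (lact eq_left g z) a;
  eq_lprincipal :
    homeo_on [set p : G * Z | src GG p.1 = lanchor eq_left p.2]
             [set q : Z * Z | ranchor eq_right q.1 = ranchor eq_right q.2]
             (fun p => (lact eq_left p.1 p.2, p.2));
  eq_rprincipal :
    homeo_on [set p : Z * H | ranchor eq_right p.1 = rng HH p.2]
             [set q : Z * Z | lanchor eq_left q.1 = lanchor eq_left q.2]
             (fun p => (p.1, ract eq_right p.1 p.2))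
}.

Section Reduced.
Context (R : realType) (H0 H : topologicalType) (HH : groupoid H0 H).

Definition conv (f g : H -> R[i]) (a : H) : R[i] :=
  \sum_(b \in [set b | rng HH b = rng HH a]) f b * g (mul HH (inv HH b) a).

Definition invol (f : H -> R[i]) (a : H) : R[i] := (f (inv HH a))^*.

(* Squared norm in l^2(s^-1(x)). *)
Definition l2sq (x : H0) (psi : H -> R[i]) : \bar R :=
  (\esum_(a in [set a | src HH a = x]) (abs2 (psi a))%:E)%E.

(* The square of the reduced norm, sup_x ||pi_x(f)||, where
   pi_x(f) psi = conv f psi is the regular representation on l^2(s^-1(x)). *)
Definition red_norm2 (f : H -> R[i]) : \bar R :=
  ereal_sup [set t | exists (x : H0) (psi : H -> R[i]),
    (l2sq x psi <= 1)%E /\ t = l2sq x (conv f psi)].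

(* B is the completion of the convolution *-algebra Cc(H) in the reduced norm,
   by way of iota; values of iota off Cc(H) are irrelevant. *)
Record is_reduced_cstar (B : cstar_algebra R) (iota : (H -> R[i]) -> B)
    : Prop := {
  red_linear : forall k f g, Cc f -> Cc g ->
    iota (fun a => k * f a + g a) = k *: iota f + iota g;
  red_mul : forall f g, Cc f -> Cc g ->
    Cc (conv f g) /\ iota (conv f g) = cmul (iota f) (iota g);
  red_adj : forall f, Cc f -> iota (invol f) = cadj (iota f);
  red_norm : forall f, Cc f -> (complex.Re (`|iota f| ^+ 2))%:E = red_norm2 f;
  red_dense : closure (iota @` [set f | Cc f]) = setT
}.

End Reduced.

Section Bimodule.
Context (R : realType) (G0 : topologicalType) (G : ptopologicalType)
  (H0 H : topologicalType) (GG : groupoid G0 G) (HH : groupoid H0 H)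
  (Z : ptopologicalType) (ZZ : equivalence GG HH Z)
  (nu : G0 -> {measure set (borel G) -> \bar R}).

Definition Zact (xi : Z -> R[i]) (g : H -> R[i]) (z : Z) : R[i] :=
  \sum_(a \in [set a | rng HH a = ranchor ZZ z])
    xi (ract ZZ z a) * g (inv HH a).

(* The inner product at a, computed from a point z with ranchor z = rng a. *)
Definition Zdot (xi1 xi2 : Z -> R[i]) (a : H) (z : Z) : R[i] :=
  Cintegral (nu (lanchor ZZ z)) [set g | rng GG g = lanchor ZZ z]
    (fun g => (xi1 (lact ZZ (inv GG g) z))^* *
              xi2 (ract ZZ (lact ZZ (inv GG g) z) a)).

(* V is the right module L^2(Z): the completion of the pre-Hilbert Cc(H)-module
   Cc(Z), by way of kappa. *)
Record is_L2Z (B : cstar_algebra R) (iota : (H -> R[i]) -> B)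
    (V : cstar_module B) (kappa : (Z -> R[i]) -> V) : Prop := {
  L2Z_linear : forall k xi1 xi2, Cc xi1 -> Cc xi2 ->
    kappa (fun z => k * xi1 z + xi2 z) = k *: kappa xi1 + kappa xi2;
  L2Z_act : forall xi g, Cc xi -> Cc g ->
    Cc (Zact xi g) /\ kappa (Zact xi g) = mact (kappa xi) (iota g);
  L2Z_dot : forall xi1 xi2, Cc xi1 -> Cc xi2 ->
    exists k : H -> R[i], [/\ Cc k,
      forall a z, ranchor ZZ z = rng HH a -> k a = Zdot xi1 xi2 a z &
      mdot (kappa xi1) (kappa xi2) = iota k];
  L2Z_dense : closure (kappa @` [set xi | Cc xi]) = setT
}.

Definition fibre (x : H0) : set Z := [set z | ranchor ZZ z = x].

(* The measure f |-> \int f(g^-1 z) dnu^{rho(z)}(g) on the fibre Z_x, as a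
   measure on Z: the image of nu^{rho(z)} under g |-> g^-1 z, for every z in
   Z_x. *)
Definition is_fibre_measure (x : H0) (mu : {measure set (borel Z) -> \bar R})
    : Prop :=
  forall (z : Z) (A : set (borel Z)), fibre x z -> measurable A ->
    mu A = nu (lanchor ZZ z)
             [set g | rng GG g = lanchor ZZ z /\ A (lact ZZ (inv GG g) z)].

(* h is the completion of L^2(Z) in <e1, e2>_x = omega_x (e1 | e2), by way of
   loc, and is identified with L^2(Z_x) by way of cls. *)
Record is_localisation (B : cstar_algebra R) (iota : (H -> R[i]) -> B)
    (V : cstar_module B) (kappa : (Z -> R[i]) -> V) (x : H0)
    (omega : B -> R[i]) (mu : {measure set (borel Z) -> \bar R})
    (h : hilbert_space R) (cls : (borel Z -> R[i]) -> h) (loc : V -> h)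
    : Prop := {
  loc_state : is_state omega;
  loc_state_Cc : forall f, Cc f -> omega (iota f) = f (unt HH x);
  loc_measure : is_fibre_measure x mu;
  loc_L2 : is_L2 mu (fibre x) cls;
  loc_linear : forall k u v, loc (k *: u + v) = k *: loc u + loc v;
  loc_dot : forall u v, hdot (loc u) (loc v) = omega (mdot u v);
  loc_dense : closure (range loc) = setT;
  loc_Cc : forall xi, Cc xi -> loc (kappa xi) = cls xi
}.

(* For rng a = x, the translate e_x^a in L^2(Z_x): the class of y |-> f (y a),
   where f is a function on Z_{s(a)} representing the localisation of e. *)
Definition translate (V : Type) (h : H0 -> hilbert_space R)
    (mu : H0 -> {measure set (borel Z) -> \bar R})
    (cls : forall x, (borel Z -> R[i]) -> h x) (loc : forall x, V -> h x)
    (x : H0) (e : V) (a : H) : h x :=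
  let y0 := src HH a in
  let f : Z -> R[i] :=
    xget 0 [set f | L2fun (mu y0) (fibre y0) f /\ cls y0 f = loc y0 e] in
  cls x (fun y => f (ract ZZ y a)).

End Bimodule.

(* Main.v *)
Require Import Defs.
From HB Require Import structures.
From mathcomp Require Import all_boot all_order all_algebra finmap complex.
From mathcomp Require Import all_classical all_reals all_analysis.
From mathcomp Require Import measurable_realfun ring lra.
From mathcomp Require showcase.summability.
Import Defs.
Set Implicit Arguments.
Unset Strict Implicit.
Unset Printing Implicit Defensive.
Import Order.TTheory GRing.Theory Num.Theory numFieldNormedType.Exports.
Local Open Scope classical_set_scope.
Local Open Scope ring_scope.

(** Write [T_A] for the frame operator [v |-> sum of e_j (e_j | v)] over a
    finite set [A] of indices, and [D_A = 1 - T_A]. The theorem combines two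
    facts.

    The first ([tight_frame_parseval]) is that the translates at [x] are a
    normalised tight frame exactly when the Parseval identity
      [sum_j omega_x ((v | e_j) (e_j | v)) = omega_x (v | v)]
    holds for all [v] in [E]. In the GNS space of [omega_x] a compactly
    supported function on the etale groupoid is its restriction to the discrete
    source fibre over [x], so functions equal to point masses on this fibre are
    an orthonormal basis ([state_parseval]). The translate of [e] by [a] is the
    localisation of [e g], where [g] is a point mass at the inverse of [a]
    ([translateE]); its scalar product with the localisation of [v] is
    therefore a coefficient of [(e | v)], and summing over [a] gives [omega_x
    ((v | e) (e | v))] ([translate_parseval]).

    The second ([frame_parseval]) is that a family in [E] is a frame exactly
    when its Parseval series converge in norm and satisfy the Parseval identity
    in every localisation. The localisations determine the norms of the algebra
    and of the module ([reduced_norming], [vnorming]), because the reduced norm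
    is that of the regular representations; so operator inequalities may be
    proved in each localisation separately.

    Given the Parseval identities, [0 <= T_A <= 1], whence [D_A^2 <= D_A]
    ([form_defect_le]), and the square of the norm of [D_A v] is at most the
    norm of the tail of the Parseval series of [v] ([defect_small]). Hence
    [T_A] converges pointwise to the identity, and, being bounded and
    self-adjoint, also strictly ([frame_of_defect]).

    Conversely, strict convergence gives [T_A z --> z] for [z] in the span of
    the vectors [u (w | v)]. This span is dense in [E], since [v (1 - p)^n]
    tends to [0] for [p = (v | v)] of norm at most [1] ([iter_energy]). The
    sums [(z | T_A z)] increase with [A], so they are bounded by [(z | z)];
    this bound passes to [E] ([frame_bessel]) and makes all [D_A] contractions,
    so that [T_A] converges pointwise on [E]. Pairing with [v] gives the
    convergence of the Parseval series and its sum. *)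

(** * Norms as real numbers, and squared seminorms *)

Section RealNorm.
Context (R : realType).
Implicit Type V : normedModType R[i].

(** Norms take values in [R[i]], which is only partially ordered; estimates are
    made in [R]. *)
Definition rn V (v : V) : R := complex.Re `|v|.

Lemma normE V (v : V) : `|v| = ((rn v)%:C)%C.
Proof. by rewrite /rn RRe_real ?normr_real. Qed.

Lemma rn_ge0 V (v : V) : 0 <= rn v.
Proof. by have := normr_ge0 v; rewrite normE ler0c. Qed.

Lemma rnD V (u v : V) : rn (u + v) <= rn u + rn v.
Proof. by have := ler_normD u v; rewrite !normE -rmorphD lecR. Qed.

Lemma rnN V (u : V) : rn (- u) = rn u.
Proof. by rewrite /rn normrN. Qed.

Lemma rnB V (u v : V) : rn (u - v) = rn (v - u).
Proof. by rewrite /rn distrC. Qed.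

Lemma rn0 V : rn (0 : V) = 0.
Proof. by rewrite /rn normr0. Qed.

Lemma rn_eq0 V (v : V) : rn v = 0 -> v = 0.
Proof. by move=> v0; apply/eqP; rewrite -normr_eq0 normE v0. Qed.

Lemma rnZ V (a : R[i]) (v : V) : rn (a *: v) = complex.Re `|a| * rn v.
Proof.
apply: complexI; rewrite -normE normrZ normE rmorphM /=.
by rewrite RRe_real ?normr_real.
Qed.

Lemma rn_sum V I (r : seq I) (P : pred I) (F : I -> V) :
  rn (\sum_(i <- r | P i) F i) <= \sum_(i <- r | P i) rn (F i).
Proof.
elim/big_ind2: _ => [|u a v b ua vb|//]; first by rewrite rn0.
by apply: le_trans (rnD _ _) _; rewrite lerD.
Qed.

Lemma closure_rnP V (S : set V) v :
  closure S v <-> forall e : R, 0 < e -> exists2 s, S s & rn (v - s) < e.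
Proof.
split=> [Sv e e0|Sv U].
  have eC : 0 < (e%:C)%C :> R[i] by rewrite ltcR.
  have [s [Ss]] := Sv _ (nbhsx_ballx v _ eC).
  by rewrite -ball_normE /= normE ltcR; exists s.
rewrite -nbhs_ballE => -[d /= d0 dU].
have dE : ((complex.Re d)%:C)%C = d by rewrite RRe_real // gtr0_real.
have [|s Ss vs] := Sv (complex.Re d); first by rewrite -ltcR dE.
exists s; split=> //; apply: dU; rewrite -ball_normE /= normE.
by rewrite -dE ltcR.
Qed.

Lemma Re_rn2 V (v : V) : complex.Re (`|v| ^+ 2) = rn v ^+ 2.
Proof. by rewrite normE -rmorphXn. Qed.

Lemma abs2_ge0 (z : R[i]) : 0 <= abs2 z.
Proof. by rewrite addr_ge0 ?sqr_ge0. Qed.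

Lemma abs2E (z : R[i]) : abs2 z = complex.Re `|z| ^+ 2.
Proof.
apply: complexI; rewrite /abs2 add_Re2_Im2.
by rewrite -[in LHS](RRe_real (normr_real z)) -rmorphXn.
Qed.

Lemma conj_abs2 (z : R[i]) : z^* * z = ((abs2 z)%:C)%C.
Proof.
case: z => [a b]; apply/eqP; rewrite eq_complex /abs2 /=; apply/andP.
by split; apply/eqP; ring.
Qed.

(** The weighted form of [(a + b)^2 <= 2 a^2 + 2 b^2]; minimising over the
    weight [t] gives the triangle inequality. *)
Lemma sqr_weight (t a b : R) :
  0 < t -> (a + b) ^+ 2 <= (1 + t) * a ^+ 2 + (1 + t^-1) * b ^+ 2.
Proof.
move=> t0; rewrite -subr_ge0.
have -> : (1 + t) * a ^+ 2 + (1 + t^-1) * b ^+ 2 - (a + b) ^+ 2 =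
   t * (a - t^-1 * b) ^+ 2 by field; apply/lt0r_neq0.
by rewrite mulr_ge0 ?sqr_ge0 // ltW.
Qed.

Lemma le_eps_sq (a b K : R) : 0 <= K ->
  (forall e, 0 < e -> a <= b + K * e ^+ 2) -> a <= b.
Proof.
move=> K0 H; apply/ler_addgt0Pr => e e0.
have K1 : 0 < K + 1 by rewrite ltr_wpDl.
have q0 : 0 < e / (K + 1) by rewrite divr_gt0.
apply: le_trans (H (Num.sqrt (e / (K + 1))) _) _; first by rewrite sqrtr_gt0.
rewrite (sqr_sqrtr (ltW q0)) lerD2l mulrCA ger_pMr //.
by rewrite ler_pdivrMr // mul1r lerDl.
Qed.

Lemma le_weight (a b : R) : 0 <= b ->
  (forall t, 0 < t -> a <= (1 + t) ^+ 2 * b) -> a <= b.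
Proof.
move=> b0 H; apply/ler_addgt0Pr => e e0.
have [e1|e1] := leP e 1.
  have b1 : 0 < 3 * b + 1 by rewrite ltr_wpDl // mulr_ge0.
  (* For [t <= 1] one has [(1 + t) ^+ 2 <= 1 + 3 * t]. *)
  pose t := e / (3 * b + 1).
  have t0 : 0 < t by rewrite divr_gt0.
  have tE : t * (3 * b + 1) = e by rewrite /t divfK // gt_eqF.
  have t1 : t <= 1 by rewrite /t ler_pdivrMr // mul1r; lra.
  by apply: le_trans (H _ t0) _; nra.
have t0 : 0 < (3 * b + 1)^-1 by rewrite invr_gt0; lra.
have tE : (3 * b + 1)^-1 * (3 * b + 1) = 1 by rewrite mulVf // gt_eqF //; lra.
have t1 : (3 * b + 1)^-1 <= 1 by rewrite invf_le1; lra.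
by apply: le_trans (H _ t0) _; nra.
Qed.

(** Squares of continuous seminorms. The weighted inequality says that the
    square root is subadditive, and is stable under sums. *)
Record quad V (F : V -> R) : Prop := {
  quad_ge0 : forall v, 0 <= F v;
  quad_add : forall t u w, 0 < t ->
    F (u + w) <= (1 + t) * F u + (1 + t^-1) * F w;
  quad_bd : exists2 C, 0 <= C & forall v, F v <= C * rn v ^+ 2
}.

Lemma quad_sum V I (r : seq I) (F : I -> V -> R) :
  (forall i, quad (F i)) -> quad (fun v => \sum_(i <- r) F i v).
Proof.
move=> qF; split=> [v|t u w t0|].
- by apply: sumr_ge0 => i _; apply: quad_ge0.
- rewrite !mulr_sumr -big_split /=; apply: ler_sum => i _.
  exact: quad_add.
- elim: r => [|i r [C C0 HC]].
    by exists 0 => // v; rewrite big_nil mul0r.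
  have [D D0 HD] := quad_bd (qF i).
  exists (D + C); first exact: addr_ge0.
  by move=> v; rewrite big_cons mulrDl lerD.
Qed.

Lemma quad_scale V (F : V -> R) k : 0 <= k -> quad F -> quad (fun v => k * F v).
Proof.
move=> k0 qF; split=> [v|t u w t0|].
- by rewrite mulr_ge0 ?quad_ge0.
- by rewrite !(mulrCA _ k) -mulrDr ler_wpM2l ?quad_add.
- have [C C0 HC] := quad_bd qF; exists (k * C); first exact: mulr_ge0.
  by move=> v; rewrite -mulrA ler_wpM2l.
Qed.

Lemma quad_comp (U V : normedModType R[i]) (f : U -> V) (F : V -> R) K :
  (forall u v, f (u + v) = f u + f v) ->
  0 <= K -> (forall u, rn (f u) <= K * rn u) ->
  quad F -> quad (F \o f).
Proof.
move=> fD K0 fK qF; split=> [v|t u w t0|] /=.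
- exact: quad_ge0.
- by rewrite fD quad_add.
- have [C C0 HC] := quad_bd qF.
  exists (C * K ^+ 2); first by rewrite mulr_ge0 ?sqr_ge0.
  move=> v; apply: le_trans (HC _) _; rewrite -mulrA ler_wpM2l // -exprMn.
  by rewrite ler_pXn2r ?nnegrE ?rn_ge0 // mulr_ge0 ?rn_ge0.
Qed.

Lemma quad_rn V : quad (fun v : V => rn v ^+ 2).
Proof.
split=> [v|t u w t0|]; first exact: sqr_ge0.
- apply: le_trans (sqr_weight _ _ t0).
  by rewrite ler_pXn2r ?nnegrE ?addr_ge0 ?rn_ge0 ?rnD.
- by exists 1 => // v; rewrite mul1r.
Qed.

Lemma quad_abs2 V (f : V -> R[i]) K :
  (forall u v, f (u + v) = f u + f v) ->
  (forall u, abs2 (f u) <= K * rn u ^+ 2) -> quad (fun v => abs2 (f v)).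
Proof.
move=> fD fK; split=> [v|t u w t0|]; first exact: abs2_ge0.
- rewrite fD; case: (f u) (f w) => [a b] [c d]; rewrite /abs2 /=.
  have := sqr_weight a c t0; have := sqr_weight b d t0.
  by rewrite !mulrDr; lra.
- exists `|K| => // v; apply: le_trans (fK _) _.
  by rewrite ler_wpM2r ?sqr_ge0 ?ler_norm.
Qed.

Lemma quad_form V (beta : V -> V -> R) K :
  (forall u v w, beta (u + v) w = beta u w + beta v w) ->
  (forall (a : R) u w, beta ((a%:C)%C *: u) w = a * beta u w) ->
  (forall u v, beta u v = beta v u) ->
  (forall u, 0 <= beta u u) ->
  (forall u, beta u u <= K * rn u ^+ 2) -> quad (fun v => beta v v).
Proof.
move=> bD bZ bC b0 bK; split=> // [t u w t0|].
  have := b0 (((- t)%:C)%C *: u + w).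
  rewrite !bD !bZ !(bC _ (_ + _)) !bD !bZ (bC w u).
  set a := beta u u; set b := beta u w; set c := beta w w => h.
  have {}h : 0 <= t * a - 2 * b + t^-1 * c.
    have -> : t * a - 2 * b + t^-1 * c = t^-1 *
      (- t * (- t * a) + - t * b + (- t * b + c)) by field; apply: lt0r_neq0.
    apply: mulr_ge0; first by rewrite invr_ge0 ltW.
    by move: h; lra.
  by rewrite !mulrDl; lra.
exists `|K| => // v; apply: le_trans (bK _) _.
by rewrite ler_wpM2r ?sqr_ge0 ?ler_norm.
Qed.

(** If [w] in [S] approximates [v], then [F v] is close to [F w] and [G w] is
    close to [G v], up to factors [1 + t] with [t] arbitrarily small. *)
Lemma quad_closure V (F G : V -> R) (S : set V) v : quad F -> quad G ->
  (forall s, S s -> F s <= G s) -> closure S v -> F v <= G v.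
Proof.
move=> qF qG FG /closure_rnP Sv.
have [C C0 HC] := quad_bd qF; have [D D0 HD] := quad_bd qG.
apply: le_weight => [|t t0]; first exact: quad_ge0.
pose s := 1 + t^-1; have s0 : 0 <= s by rewrite addr_ge0 ?invr_ge0 ?ltW.
have t1 : 0 <= 1 + t by rewrite addr_ge0 // ltW.
have K0 : 0 <= (1 + t) * s * D + s * C by rewrite addr_ge0 ?mulr_ge0.
apply: (le_eps_sq K0) => e /Sv[w Sw /ltW vw].
have vw2 : rn (v - w) ^+ 2 <= e ^+ 2.
  by rewrite ler_pXn2r ?nnegrE ?rn_ge0 // (le_trans (rn_ge0 _) vw).
have h1 : F v <= (1 + t) * F w + s * (C * e ^+ 2).
  have := quad_add qF w (v - w) t0; rewrite addrC subrK => /le_trans; apply.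
  by rewrite lerD2l ler_wpM2l // (le_trans (HC _)) // ler_wpM2l.
have h2 : G w <= (1 + t) * G v + s * (D * e ^+ 2).
  have := quad_add qG v (w - v) t0; rewrite addrC subrK => /le_trans; apply.
  by rewrite lerD2l ler_wpM2l // (le_trans (HD _)) // ler_wpM2l // rnB.
apply: (le_trans h1).
have := ler_wpM2l t1 (le_trans (FG _ Sw) h2).
set X := e ^+ 2; set Y := G v; set A := F w => h3.
have -> : (1 + t) ^+ 2 * Y + ((1 + t) * s * D + s * C) * X =
  (1 + t) * ((1 + t) * Y + s * (D * X)) + s * (C * X) by ring.
by rewrite lerD2r.
Qed.

Lemma quad_closure0 V (F : V -> R) (S : set V) v : quad F ->
  (forall s, S s -> F s = 0) -> closure S v -> F v = 0.
Proof.
move=> qF FS Sv; apply/eqP; rewrite eq_le quad_ge0 // andbT.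
have q0 : quad (fun _ : V => 0 : R).
  split=> [//|t u w t0|]; first by rewrite !mulr0 addr0.
  by exists 0 => // w; rewrite mul0r.
by apply: (quad_closure qF q0 _ Sv) => s /FS ->.
Qed.

End RealNorm.

(** * C*-algebras and Hilbert modules in the GNS representations of states *)

Section Additive.
Context (U V : zmodType) (f : U -> V).
Hypothesis fD : forall u v, f (u + v) = f u + f v.

Lemma add_fun0 : f 0 = 0.
Proof. by apply: (addIr (f 0)); rewrite -fD !add0r. Qed.

Lemma add_funN u : f (- u) = - f u.
Proof. by apply: (addIr (f u)); rewrite -fD !addNr add_fun0. Qed.

Lemma add_funB u v : f (u - v) = f u - f v.
Proof. by rewrite fD add_funN. Qed.

Lemma add_fun_sum I (r : seq I) (F : I -> U) :
  f (\sum_(i <- r) F i) = \sum_(i <- r) f (F i).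
Proof. exact: (big_morph f fD add_fun0). Qed.

End Additive.

Section LinearFun.
Context (R : realType) (U V : lmodType R[i]) (f : U -> V).
Hypothesis fL : forall k u v, f (k *: u + v) = k *: f u + f v.

Lemma lin_funD u v : f (u + v) = f u + f v.
Proof. by have := fL 1 u v; rewrite !scale1r. Qed.

Lemma lin_funZ k u : f (k *: u) = k *: f u.
Proof. by have := fL k u 0; rewrite !addr0 (add_fun0 lin_funD) addr0. Qed.

End LinearFun.

Section ComplexParts.
Context (R : realType).

Lemma ReD (z w : R[i]) : complex.Re (z + w) = complex.Re z + complex.Re w.
Proof. by case: z w => [? ?] [? ?]. Qed.

Lemma ReB (z w : R[i]) : complex.Re (z - w) = complex.Re z - complex.Re w.
Proof. by case: z w => [? ?] [? ?]. Qed.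

Lemma ReZ (a : R) (z : R[i]) : complex.Re ((a%:C)%C * z) = a * complex.Re z.
Proof. by case: z => [? ?] /=; rewrite mul0r subr0. Qed.

Lemma Re_sum I (r : seq I) (F : I -> R[i]) :
  complex.Re (\sum_(i <- r) F i) = \sum_(i <- r) complex.Re (F i).
Proof. exact: (add_fun_sum ReD). Qed.

Lemma Re_conj (z : R[i]) : complex.Re (z^*) = complex.Re z.
Proof. by case: z. Qed.

Lemma conj_real (a : R) : ((a%:C)%C)^* = (a%:C)%C :> R[i].
Proof. by apply/eqP; rewrite eq_complex /= oppr0 !eqxx. Qed.

Lemma Re_le_norm (z : R[i]) : complex.Re z <= complex.Re `|z|.
Proof.
case: z => a b; rewrite normc_def /=; apply: le_trans (ler_norm a) _.
by rewrite -sqrtr_sqr ler_wsqrtr // lerDl sqr_ge0.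
Qed.

End ComplexParts.

Section CstarBasics.
Context (R : realType) (B : cstar_algebra R).
Implicit Types a b c : B.

Lemma cmulDl c a b : cmul (a + b) c = cmul a c + cmul b c.
Proof. exact: (lin_funD (cmul_linearl c)). Qed.

Lemma cmulDr c a b : cmul c (a + b) = cmul c a + cmul c b.
Proof. exact: (lin_funD (cmul_linearr c)). Qed.

Lemma cmulZl c k a : cmul (k *: a) c = k *: cmul a c.
Proof. exact: (lin_funZ (cmul_linearl c)). Qed.

Lemma cmulZr c k a : cmul c (k *: a) = k *: cmul c a.
Proof. exact: (lin_funZ (cmul_linearr c)). Qed.

Lemma cmulBl c a b : cmul (a - b) c = cmul a c - cmul b c.
Proof. exact: (add_funB (cmulDl c)). Qed.

Lemma cmulBr c a b : cmul c (a - b) = cmul c a - cmul c b.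
Proof. exact: (add_funB (cmulDr c)). Qed.

Lemma cadjD a b : cadj (a + b) = cadj a + cadj b.
Proof. by have := cadj_antilinear 1 a b; rewrite scale1r rmorph1 scale1r. Qed.

Lemma cadjZ k a : cadj (k *: a) = k^* *: cadj a.
Proof.
by have := cadj_antilinear k a 0; rewrite addr0 (add_fun0 cadjD) addr0.
Qed.

Lemma rn_cmul a b : rn (cmul a b) <= rn a * rn b.
Proof. by have := cmul_norm a b; rewrite !normE -rmorphM lecR. Qed.

Lemma rn_cstar a : rn (cmul (cadj a) a) = rn a ^+ 2.
Proof. by apply: complexI; have := cstar_norm a; rewrite !normE -rmorphXn. Qed.

Lemma rn_cadj a : rn (cadj a) = rn a.
Proof.
have le b : rn b <= rn (cadj b).
  have [b0|b0] := eqVneq (rn b) 0; first by rewrite b0 rn_ge0.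
  have bp : 0 < rn b by rewrite lt_neqAle eq_sym b0 rn_ge0.
  by rewrite -(ler_pM2r bp) -expr2 -rn_cstar rn_cmul.
by apply/eqP; rewrite eq_le le andbT -{2}(cadjK a) le.
Qed.

End CstarBasics.

Section ModuleBasics.
Context (R : realType) (B : cstar_algebra R) (V : cstar_module B).
Implicit Types (u v w : V) (a b c : B).

Lemma mactDl b u v : mact (u + v) b = mact u b + mact v b.
Proof. exact: (lin_funD (mact_linearl b)). Qed.

Lemma mactZl b k u : mact (k *: u) b = k *: mact u b.
Proof. exact: (lin_funZ (mact_linearl b)). Qed.

Lemma mactBl b u v : mact (u - v) b = mact u b - mact v b.
Proof. exact: (add_funB (mactDl b)). Qed.

Lemma mactDr u a b : mact u (a + b) = mact u a + mact u b.
Proof. exact: (lin_funD (mact_linearr u)). Qed.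

Lemma mactBr u a b : mact u (a - b) = mact u a - mact u b.
Proof. exact: (add_funB (mactDr u)). Qed.

Lemma mdotDr u v w : mdot u (v + w) = mdot u v + mdot u w.
Proof. exact: (lin_funD (mdot_linear u)). Qed.

Lemma mdotZr u k v : mdot u (k *: v) = k *: mdot u v.
Proof. exact: (lin_funZ (mdot_linear u)). Qed.

Lemma mdotBr u v w : mdot u (v - w) = mdot u v - mdot u w.
Proof. exact: (add_funB (mdotDr u)). Qed.

Lemma mdotDl w u v : mdot (u + v) w = mdot u w + mdot v w.
Proof. by rewrite mdot_adj mdotDr cadjD -!mdot_adj. Qed.

Lemma mdotBl w u v : mdot (u - v) w = mdot u w - mdot v w.
Proof. exact: (add_funB (mdotDl w)). Qed.

Lemma mdot_actl u v b : mdot (mact u b) v = cmul (cadj b) (mdot u v).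
Proof. by rewrite mdot_adj mdot_act cadjM -mdot_adj. Qed.

Lemma rn_mdotvv u : rn (mdot u u) = rn u ^+ 2.
Proof.
by apply: complexI; have := mdot_norm u; rewrite !normE -rmorphXn => ->.
Qed.

End ModuleBasics.

(** The squared norm of the vector defined by [b] in the GNS space of [w]. *)
Definition sq (R : realType) (B : cstar_algebra R) (w : B -> R[i]) (b : B)
    : R :=
  complex.Re (w (cmul (cadj b) b)).

Record contractive_states (R : realType) (B : cstar_algebra R) (X : Type)
    (omega : X -> B -> R[i]) : Prop := {
  om_linear : forall x k a b, omega x (k *: a + b) = k * omega x a + omega x b;
  om_pos : forall x a, 0 <= omega x (cmul (cadj a) a);
  om_adj : forall x a, omega x (cadj a) = (omega x a)^*;
  om_le : forall x a, `|omega x a| <= `|a|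
}.

(** The GNS representations of the states are contractive, and together they
    compute the norm. An operator inequality in the algebra then amounts to
    inequalities between real quadratic forms. *)
Record norming_states (R : realType) (B : cstar_algebra R) (X : Type)
    (omega : X -> B -> R[i]) : Prop := {
  om_states :> contractive_states omega;
  om_bound : forall x b c,
    sq (omega x) (cmul b c) <= rn b ^+ 2 * sq (omega x) c;
  om_norming : forall b M, 0 <= M ->
    (forall x c, sq (omega x) (cmul b c) <= M * sq (omega x) c) ->
    rn b ^+ 2 <= M
}.

Section States.
Context (R : realType) (B : cstar_algebra R) (X : Type)
  (omega : X -> B -> R[i]) (Hom : contractive_states omega)
  (V : cstar_module B).
Implicit Types (x : X) (u v w : V) (a b c : B).

Lemma omD x a b : omega x (a + b) = omega x a + omega x b.
Proof. by have := om_linear Hom x 1 a b; rewrite scale1r mul1r. Qed.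

Lemma omB x a b : omega x (a - b) = omega x a - omega x b.
Proof. exact: (add_funB (omD x)). Qed.

Lemma omZ x k a : omega x (k *: a) = k * omega x a.
Proof. by have := om_linear Hom x k a 0; rewrite (add_fun0 (omD x)) !addr0. Qed.

Lemma Re_om_le x a : complex.Re (omega x a) <= rn a.
Proof.
apply: le_trans (Re_le_norm _) _; rewrite -lecR -normE.
by apply: le_trans (om_le Hom x a); rewrite RRe_real ?normr_real.
Qed.

Lemma sq_ge0 x b : 0 <= sq (omega x) b.
Proof. by have := om_pos Hom x b; rewrite lecE /= => /andP[]. Qed.

Lemma sq_le x b : sq (omega x) b <= 1 * rn b ^+ 2.
Proof. by rewrite mul1r -rn_cstar Re_om_le. Qed.

(** The real part of the scalar product of the localisations of [u] and [v]. *)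
Definition form x u v : R := complex.Re (omega x (mdot u v)).

Lemma formDr x u v w : form x u (v + w) = form x u v + form x u w.
Proof. by rewrite /form mdotDr omD ReD. Qed.

Lemma formBr x u v w : form x u (v - w) = form x u v - form x u w.
Proof. by rewrite /form mdotBr omB ReB. Qed.

Lemma formC x u v : form x u v = form x v u.
Proof. by rewrite /form mdot_adj om_adj // Re_conj. Qed.

Lemma formDl x u v w : form x (u + v) w = form x u w + form x v w.
Proof. by rewrite -!(formC _ w) formDr. Qed.

Lemma formBl x u v w : form x (u - v) w = form x u w - form x v w.
Proof. by rewrite -!(formC _ w) formBr. Qed.

Lemma formZr x (a : R) u v : form x u ((a%:C)%C *: v) = a * form x u v.
Proof. by rewrite /form mdotZr omZ ReZ. Qed.

Lemma formZl x (a : R) u v : form x ((a%:C)%C *: u) v = a * form x u v.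
Proof. by rewrite formC formZr formC. Qed.

Lemma form_ge0 x v : 0 <= form x v v.
Proof.
by rewrite /form; have [d ->] := mdot_pos v; exact: sq_ge0.
Qed.

Lemma form_le x v : form x v v <= 1 * rn v ^+ 2.
Proof. by rewrite mul1r -rn_mdotvv Re_om_le. Qed.

Lemma quad_vsq x : quad (fun v => form x v v).
Proof.
exact: (quad_form (formDl x) (formZl x) (formC x) (form_ge0 x) (form_le x)).
Qed.

Definition bform x a b : R := complex.Re (omega x (cmul (cadj a) b)).

Lemma bformDl x a b c : bform x (a + b) c = bform x a c + bform x b c.
Proof. by rewrite /bform cadjD cmulDl omD ReD. Qed.

Lemma bformZl x (k : R) a b : bform x ((k%:C)%C *: a) b = k * bform x a b.
Proof.
rewrite /bform cadjZ cmulZl omZ.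
by rewrite conj_real ReZ.
Qed.

Lemma bformC x a b : bform x a b = bform x b a.
Proof. by rewrite /bform -(cadjK b) -cadjM om_adj // Re_conj cadjK. Qed.

Lemma bformBl x a b c : bform x (a - b) c = bform x a c - bform x b c.
Proof. exact: (@add_funB _ _ (bform x ^~ c) (fun a b => bformDl x a b c)). Qed.

Lemma quad_sq x : quad (sq (omega x)).
Proof.
exact: (quad_form (bformDl x) (bformZl x) (bformC x) (sq_ge0 x) (sq_le x)).
Qed.

End States.

Section Localised.
Context (R : realType) (B : cstar_algebra R) (X : Type)
  (omega : X -> B -> R[i]) (Hom : norming_states omega) (V : cstar_module B).
Implicit Types (x : X) (u v w : V) (a b c : B).

Local Notation form := (form omega).
Local Notation bform := (bform omega).

(** With [d] in place of the norm of [a], this is the Cauchy-Schwarz inequality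
    for [c] and [a c], obtained from the positivity of [d c - a c]. *)
Lemma bform_le x a c (d : R) : 0 < d -> rn a <= d ->
  bform x c (cmul a c) <= d * sq (omega x) c.
Proof.
move=> d0 ad; set y := cmul a c.
have h : 0 <= bform x ((d%:C)%C *: c - y) ((d%:C)%C *: c - y) := sq_ge0 Hom x _.
move: h; rewrite (bformBl Hom) (bformZl Hom) !(bformC Hom x _ (_ - _)).
rewrite !(bformBl Hom) !(bformZl Hom) (bformC Hom x y c) => h.
have c0 : 0 <= bform x c c := sq_ge0 Hom x c.
have yd : bform x y y <= d ^+ 2 * bform x c c.
  apply: le_trans (om_bound Hom _ _ _) _; rewrite ler_wpM2r //.
  by rewrite ler_pXn2r ?nnegrE ?rn_ge0 // ltW.
rewrite -(ler_pM2l d0) -[sq _ _]/(bform x c c).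
by move: h yd; rewrite expr2; nra.
Qed.

(** The square root [d] of [(v | v)] transports the bounds from the algebra to
    the module. *)
Lemma vsq_actE v : exists2 d : B, rn d ^+ 2 = rn v ^+ 2 &
  forall x c, form x (mact v c) (mact v c) = sq (omega x) (cmul d c).
Proof.
have [d dE] := mdot_pos v; exists d; first by rewrite -rn_cstar -dE rn_mdotvv.
by move=> x c; rewrite /form /sq mdot_act mdot_actl dE cadjM !cmulA.
Qed.

Lemma vsq_act x v c :
  form x (mact v c) (mact v c) <= rn v ^+ 2 * sq (omega x) c.
Proof. by have [d <- ->] := vsq_actE v; exact: om_bound. Qed.

Lemma vnorming v M : 0 <= M ->
  (forall x c, form x (mact v c) (mact v c) <= M * sq (omega x) c) ->
  rn v ^+ 2 <= M.
Proof.
move=> M0 H; have [d <- dE] := vsq_actE v.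
by apply: (om_norming Hom) => // x c; rewrite -dE.
Qed.

Lemma le_sqr_rn (r s : R) : 0 <= r -> 0 <= s -> r ^+ 2 <= s ^+ 2 -> r <= s.
Proof. by move=> r0 s0; rewrite ler_pXn2r ?nnegrE. Qed.

Lemma rn_mact v b : rn (mact v b) <= rn v * rn b.
Proof.
apply: le_sqr_rn; rewrite ?mulr_ge0 ?rn_ge0 // exprMn.
apply: vnorming => [|x c]; first by rewrite mulr_ge0 ?sqr_ge0.
rewrite -mactA; apply: le_trans (vsq_act _ _ _) _.
by rewrite -[leRHS]mulrA ler_wpM2l ?sqr_ge0 // (om_bound Hom).
Qed.

(** The Cauchy-Schwarz inequality of the module, localised: with [y = u (u |
    w)], the form of [w] against [y] is the left-hand side [q], and that of [y]
    against itself is at most [rn u ^+ 2 * q]. *)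
Lemma sq_mdot x u w : sq (omega x) (mdot u w) <= rn u ^+ 2 * form x w w.
Proof.
set b := mdot u w; set q := sq _ _; set k := rn u ^+ 2.
pose y := mact u b.
have yy : form x y y <= k * q by exact: vsq_act.
have wy : form x w y = q by rewrite /form mdot_act mdot_adj.
have := form_ge0 Hom x ((k%:C)%C *: w - y).
rewrite (formBr Hom) !(formBl Hom) !(formZr Hom) !(formZl Hom).
rewrite (formC Hom x y w) wy => h.
have k0 : 0 <= k by exact: sqr_ge0.
have w0 := form_ge0 Hom x w; have q0 : 0 <= q by exact: (sq_ge0 Hom).
have [k1|k1] := eqVneq k 0.
  have b0 : mdot u w = 0.
    suff -> : u = 0.
      by rewrite mdot_adj (add_fun0 (mdotDr w)) (add_fun0 (@cadjD _ _)).
    by apply: rn_eq0; apply/eqP; rewrite -sqrf_eq0 -/k k1.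
  by rewrite k1 mul0r /q /b b0 /sq (add_fun0 (cmulDr _)) (add_fun0 (omD Hom x)).
have kp : 0 < k by rewrite lt_neqAle eq_sym k1.
rewrite -(ler_pM2l kp); nra.
Qed.

Lemma rn_mdot u v : rn (mdot u v) <= rn u * rn v.
Proof.
apply: le_sqr_rn; rewrite ?mulr_ge0 ?rn_ge0 // exprMn.
apply: (om_norming Hom) => [|x c]; first by rewrite mulr_ge0 ?sqr_ge0.
rewrite -mdot_act; apply: le_trans (sq_mdot _ _ _) _.
by rewrite -[leRHS]mulrA ler_wpM2l ?sqr_ge0 // vsq_act.
Qed.

End Localised.

(** * Unconditional sums and Parseval identities *)

Section FsetSums.
Context (R : realType) (I : choiceType) (D : set I).
Implicit Types (F : I -> R) (A : {fset I}).

Lemma esum_le_fset F (M : R) :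
  (forall A, [set` A] `<=` D -> \sum_(i <- A) F i <= M) ->
  (\esum_(i in D) (F i)%:E <= M%:E)%E.
Proof.
move=> H; apply: ge_ereal_sup => _ [S [finS SD] <-].
rewrite fsbig_finite //= sumEFin lee_fin; apply: H => i /=.
by rewrite in_fset_set // inE => /SD.
Qed.

Lemma fset_le_esum F A : [set` A] `<=` D ->
  ((\sum_(i <- A) F i)%:E <= \esum_(i in D) (F i)%:E)%E.
Proof.
move=> AD; apply: ereal_sup_ubound; exists [set` A].
  by split=> //; exact: finite_fset.
by rewrite fsbig_finite //= set_fsetK sumEFin.
Qed.

Lemma esum_eq_fset F (M : R) :
  (forall A, [set` A] `<=` D -> \sum_(i <- A) F i <= M) ->
  (forall r : R, 0 < r ->
    exists2 A : {fset I}, [set` A] `<=` D & M <= \sum_(i <- A) F i + r) ->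
  (\esum_(i in D) (F i)%:E = M%:E)%E.
Proof.
move=> H1 H2; apply/eqP; rewrite eq_le esum_le_fset //=.
apply/lee_addgt0Pr => r /H2[A AD MA].
apply: (@le_trans _ _ ((\sum_(i <- A) F i + r)%:E)); first by rewrite lee_fin.
by rewrite EFinD; apply: leeD2r; exact: fset_le_esum.
Qed.

Lemma ler_sum_fset F A A' : (forall i, 0 <= F i) -> (A `<=` A')%fset ->
  \sum_(i <- A) F i <= \sum_(i <- A') F i.
Proof.
move=> F0 AA'; pose F' i := if i \in A then F i else 0.
rewrite (@eq_big_seq _ _ _ _ _ F F') => [|i iA]; last by rewrite /F' iA.
rewrite (big_fset_incl _ AA') => [|i _ iA]; last by rewrite /F' (negbTE iA).
by apply: ler_sum => i _; rewrite /F'; case: ifP.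
Qed.

End FsetSums.

(** Approximating [v] by [s] in the subgroup [S] costs [G (v - s)] on both
    sides of the identity: on the left by the Bessel inequality, which passes
    to the closure because it only involves finite sums. *)
Lemma parseval_closure (R : realType) (V : normedModType R[i]) (I : choiceType)
    (D : set I) (F : I -> V -> R) (G : V -> R) (S : set V) :
  (forall i, quad (F i)) -> quad G ->
  (forall u v, S u -> S v -> S (u - v)) ->
  (forall s, S s -> \esum_(i in D) (F i s)%:E = (G s)%:E)%E ->
  forall v, closure S v -> (\esum_(i in D) (F i v)%:E = (G v)%:E)%E.
Proof.
move=> qF qG SB SP.
have bessel (A : {fset I}) v : [set` A] `<=` D -> closure S v ->
    \sum_(i <- A) F i v <= G v.
  move=> AD; apply: (quad_closure (quad_sum A qF) qG) => s Ss.
  by rewrite -lee_fin -SP // (fset_le_esum (F ^~ s)).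
move=> v Sv; apply/eqP; rewrite eq_le; apply/andP; split.
  by apply: (@esum_le_fset _ _ D (F ^~ v)) => A AD; exact: bessel.
have esum0 : (0 <= \esum_(i in D) (F i v)%:E)%E.
  by apply: esum_ge0 => i _; rewrite lee_fin quad_ge0.
case Mv : (\esum_(i in D) (F i v)%:E)%E esum0 => [M| |] //.
  2: by move=> _; rewrite leey.
rewrite !lee_fin => M0; have [C C0 HC] := quad_bd qG.
apply: le_weight => // t t0; pose s := 1 + t^-1.
have s0 : 0 <= s by rewrite addr_ge0 ?invr_ge0 ?ltW.
have t1 : 0 <= 1 + t by rewrite addr_ge0 // ltW.
apply: (@le_eps_sq _ _ _ ((1 + t) * s * C + s * C)).
  by rewrite addr_ge0 ?mulr_ge0.
move=> r r0; have /closure_rnP/(_ _ r0)[u Su /ltW vu] := Sv.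
have Suv : closure S (u - v).
  apply/closure_rnP => d /(iffLR (closure_rnP _ _) Sv)[w Sw vw].
  exists (u - w); first exact: SB.
  by rewrite opprB addrC addrA subrK -rnB.
have Guv w : rn w = rn (v - u) -> G w <= C * r ^+ 2.
  move=> wE; apply: le_trans (HC _) _; rewrite wE ler_wpM2l //.
  by rewrite ler_pXn2r ?nnegrE ?rn_ge0 // ltW.
have h1 : G v <= (1 + t) * G u + s * (C * r ^+ 2).
  have := quad_add qG u (v - u) t0; rewrite addrC subrK => /le_trans; apply.
  by rewrite lerD2l ler_wpM2l // Guv.
have h2 : G u <= (1 + t) * M + s * (C * r ^+ 2).
  rewrite -lee_fin -SP //; apply: (@esum_le_fset _ _ D (F ^~ u)) => A AD.
  apply: (@le_trans _ _ ((1 + t) * (\sum_(i <- A) F i v) +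
                         s * (\sum_(i <- A) F i (u - v)))).
    have := quad_add (quad_sum A qF) v (u - v) t0.
    by rewrite (addrC v) subrK.
  rewrite lerD ?ler_wpM2l //.
    by rewrite -lee_fin -Mv (fset_le_esum (F ^~ v)).
  by apply: le_trans (bessel _ _ AD Suv) _; apply: Guv; rewrite rnB.
apply: (le_trans h1); have := ler_wpM2l t1 h2.
set Y := r ^+ 2; move=> h3.
have -> : (1 + t) ^+ 2 * M + ((1 + t) * s * C + s * C) * Y =
   (1 + t) * ((1 + t) * M + s * (C * Y)) + s * (C * Y) by ring.
by rewrite lerD2r.
Qed.

(** * Frames of a submodule and the Parseval identity *)

Lemma totally_cvgP (R : realType) (V : normedModType R[i]) (J : choiceType)
    (f : {fset J} -> V) (l : V) :
  f @ summability.totally --> l <->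
  forall r : R, 0 < r -> exists A0 : {fset J},
    forall A, (A0 `<=` A)%fset -> rn (l - f A) < r.
Proof.
split=> [fl r r0|H U].
  have rC : 0 < (r%:C)%C :> R[i] by rewrite ltcR.
  have [A0 _ HA] := fl _ (nbhsx_ballx l _ rC).
  by exists A0 => A /HA /=; rewrite -ball_normE /= normE ltcR.
rewrite -nbhs_ballE => -[d /= d0 dU].
have dE : ((complex.Re d)%:C)%C = d by rewrite RRe_real // gtr0_real.
have [|A0 HA] := H (complex.Re d); first by rewrite -ltcR dE.
exists A0 => // A /HA lA; apply: dU; rewrite -ball_normE /= normE.
by rewrite -dE ltcR.
Qed.

Section FrameOperator.
Context (R : realType) (B : cstar_algebra R) (X : Type)
  (omega : X -> B -> R[i]) (Hom : norming_states omega) (V : cstar_module B)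
  (J : choiceType) (e : J -> V).
Implicit Types (x : X) (u v w : V) (a b c : B) (A : {fset J}).

Local Notation sqx x := (sq (omega x)).
Local Notation formx x := (form omega x).

Definition frame_op A v : V := \sum_(j <- A) theta (e j) (e j) v.

Definition defect A v : V := v - frame_op A v.

Definition frame_gram A v : B :=
  \sum_(j <- A) cmul (cadj (mdot (e j) v)) (mdot (e j) v).

Lemma frame_opD A u v : frame_op A (u + v) = frame_op A u + frame_op A v.
Proof.
rewrite /frame_op -big_split; apply: eq_bigr => j _.
by rewrite /theta mdotDr mactDr.
Qed.

Lemma frame_opB A u v : frame_op A (u - v) = frame_op A u - frame_op A v.
Proof. exact: (add_funB (frame_opD A)). Qed.

Lemma frame_op_act A v c : frame_op A (mact v c) = mact (frame_op A v) c.
Proof.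
rewrite /frame_op (add_fun_sum (mactDl c)); apply: eq_bigr => j _.
by rewrite /theta mdot_act mactA.
Qed.

Lemma defectD A u v : defect A (u + v) = defect A u + defect A v.
Proof. by rewrite /defect frame_opD opprD addrACA. Qed.

Lemma defectZ A k v : defect A (k *: v) = k *: defect A v.
Proof.
rewrite /defect scalerBr; congr (_ - _).
rewrite /frame_op scaler_sumr; apply: eq_bigr => j _.
by rewrite /theta mdotZr (lin_funZ (mact_linearr (e j))).
Qed.

Lemma defect_act A v c : defect A (mact v c) = mact (defect A v) c.
Proof. by rewrite /defect frame_op_act mactBl. Qed.

Lemma mdot_frame_op A u v :
  mdot u (frame_op A v) =
  \sum_(j <- A) cmul (cadj (mdot (e j) u)) (mdot (e j) v).
Proof.
rewrite /frame_op (add_fun_sum (mdotDr u)); apply: eq_bigr => j _.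
by rewrite /theta mdot_act mdot_adj.
Qed.

Lemma frame_op_sym A u v : mdot (frame_op A u) v = mdot u (frame_op A v).
Proof.
rewrite mdot_adj !mdot_frame_op (add_fun_sum (@cadjD _ _)).
by apply: eq_bigr => j _; rewrite cadjM cadjK.
Qed.

Lemma defect_sym A u v : mdot (defect A u) v = mdot u (defect A v).
Proof. by rewrite mdotBl mdotBr frame_op_sym. Qed.

Lemma form_frame_op x A v :
  formx x v (frame_op A v) = \sum_(j <- A) sqx x (mdot (e j) v).
Proof. by rewrite /form mdot_frame_op (add_fun_sum (omD Hom x)) Re_sum. Qed.

Lemma form_frame_op_ge0 x A v : 0 <= formx x v (frame_op A v).
Proof.
by rewrite form_frame_op; apply: sumr_ge0 => j _; exact: (sq_ge0 Hom).
Qed.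

Lemma form_defect x A v :
  formx x v (defect A v) = formx x v v - \sum_(j <- A) sqx x (mdot (e j) v).
Proof. by rewrite (formBr Hom) form_frame_op. Qed.

Lemma bform_frame_gram x A v c :
  bform omega x c (cmul (frame_gram A v) c) =
  \sum_(j <- A) sqx x (mdot (e j) (mact v c)).
Proof.
rewrite -form_frame_op /form frame_op_act mdot_act mdot_actl.
by rewrite mdot_frame_op /bform cmulA.
Qed.

Lemma quad_frame_sum x A : quad (fun v => \sum_(j <- A) sqx x (mdot (e j) v)).
Proof.
apply: quad_sum => j.
apply: (quad_comp (mdotDr (e j)) (rn_ge0 (e j)) _ (quad_sq Hom x)) => v.
exact: (rn_mdot Hom).
Qed.

Section Bessel.
Context (E : set V).
Hypothesis Elin : forall k u v, E u -> E v -> E (k *: u + v).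
Hypothesis Eact : forall v b, E v -> E (mact v b).
Hypothesis Ee : forall j, E (e j).

Lemma sub_mem u v : E u -> E v -> E (u - v).
Proof. by move=> Eu Ev; rewrite addrC -scaleN1r; exact: Elin. Qed.

Lemma zero_mem v : E v -> E 0.
Proof. by move=> Ev; rewrite -(subrr v); exact: sub_mem. Qed.

Lemma add_mem u v : E u -> E v -> E (u + v).
Proof. by move=> Eu Ev; rewrite -(scale1r u); exact: Elin. Qed.

Lemma scale_mem k v : E v -> E (k *: v).
Proof. by move=> Ev; rewrite -(addr0 (_ *: _)); apply: Elin (zero_mem Ev). Qed.

Lemma frame_op_mem A v : E v -> E (frame_op A v).
Proof.
move=> Ev; rewrite /frame_op.
elim/big_ind: _ => [|u w|j _]; [exact: zero_mem Ev|exact: add_mem|].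
exact: Eact.
Qed.

(** The frame operators are at most [1] on [E]. *)
Definition bessel := forall A x v, E v ->
  \sum_(j <- A) sqx x (mdot (e j) v) <= formx x v v.

Lemma form_defect_sym A x u v : formx x (defect A u) v = formx x u (defect A v).
Proof. by rewrite /form defect_sym. Qed.

(** With [T] the frame operator and [D = 1 - T], this is [D^2 <= D], read off
    from the identity [D - D^2 = T D T + D T D] with positive summands. *)
Lemma form_defect_le A x v : bessel -> E v ->
  formx x (defect A v) (defect A v) <= formx x v (defect A v).
Proof.
move=> bes Ev; set u := defect A v; set w := frame_op A v.
have vE : v = u + w by rewrite /u /defect subrK.
have Dw : defect A w = frame_op A u by rewrite /u /defect frame_opB.
rewrite {1}vE (formDl Hom) lerDl.
have uE : u = defect A u + defect A w by rewrite -defectD -vE.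
rewrite {1}uE (formDr Hom); apply: addr_ge0.
  by rewrite -form_defect_sym Dw (formC Hom) form_frame_op_ge0.
by rewrite form_defect subr_ge0; apply: bes; exact: frame_op_mem.
Qed.

Lemma form_defect_le1 A x v : bessel -> E v ->
  formx x (defect A v) (defect A v) <= formx x v v.
Proof.
move=> bes Ev; apply: le_trans (form_defect_le _ _ bes Ev) _.
rewrite form_defect gerBl; apply: sumr_ge0 => j _; exact: (sq_ge0 Hom).
Qed.

Lemma rn_defect A v : bessel -> E v -> rn (defect A v) <= rn v.
Proof.
move=> bes Ev; apply: le_sqr_rn; rewrite ?rn_ge0 //.
apply: (vnorming Hom) => [|x c]; first exact: sqr_ge0.
rewrite -defect_act; apply: le_trans (vsq_act Hom _ _ _).
by apply: form_defect_le1 => //; exact: Eact.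
Qed.

Lemma rn_frame_op A v : bessel -> E v -> rn (frame_op A v) <= 2 * rn v.
Proof.
move=> bes Ev; have -> : frame_op A v = v - defect A v by rewrite /defect subKr.
apply: le_trans (rnD _ _) _; rewrite rnN mulr_natl mulr2n lerD2l.
exact: rn_defect.
Qed.

(** The defect at [v] is controlled by the tail of the series of Gram elements:
    in each representation the form of the defect is the tail of the Parseval
    sum. *)
Lemma defect_small v : bessel -> E v ->
  (forall x w, E w ->
    (\esum_(j in setT) (sqx x (mdot (e j) w))%:E = (formx x w w)%:E)%E) ->
  in_ell2 (fun j => mdot (e j) v) ->
  forall r : R, 0 < r ->
    exists A0, forall A, (A0 `<=` A)%fset -> rn (defect A v) <= r.
Proof.
move=> bes Ev pars /cvg_ex[l /totally_cvgP cl] r r0.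
(* Two partial sums are compared through the limit, [d]-close to each. *)
pose d := r ^+ 2 / 2; have d0 : 0 < d by rewrite divr_gt0 // exprn_gt0.
have [A0 HA0] := cl _ d0.
have gramE A : summability.partial_sum
    (fun j => cmul (cadj (mdot (e j) v)) (mdot (e j) v)) A = frame_gram A v.
  by rewrite /frame_gram big_seq_fsetE.
exists A0 => A AA0; apply: le_sqr_rn; rewrite ?rn_ge0 ?(ltW r0) //.
apply: (vnorming Hom) => [|x c]; first exact: sqr_ge0.
have Ec : E (mact v c) by exact: Eact.
rewrite -defect_act; apply: le_trans (form_defect_le _ _ bes Ec) _.
rewrite form_defect lerBlDr -lee_fin -pars //.
apply: esum_le_fset => A' _.
apply: le_trans (ler_sum_fset _ (fsubsetUl A' A)) _ => [j|].
  exact: (sq_ge0 Hom).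
rewrite -!bform_frame_gram -lerBlDr.
have -> : bform omega x c (cmul (frame_gram (A' `|` A)%fset v) c) -
   bform omega x c (cmul (frame_gram A v) c) =
   bform omega x c (cmul (frame_gram (A' `|` A)%fset v - frame_gram A v) c).
  by rewrite /bform cmulBl cmulBr (omB Hom) ReB.
have r2 : r ^+ 2 = d + d by rewrite /d; field.
apply: (bform_le Hom); first by rewrite r2 addr_gt0.
have near A1 : (A0 `<=` A1)%fset -> rn (l - frame_gram A1 v) <= d.
  by move=> /HA0 /ltW; rewrite gramE.
have -> : frame_gram (A' `|` A)%fset v - frame_gram A v =
  (l - frame_gram A v) - (l - frame_gram (A' `|` A)%fset v).
  by rewrite opprB [RHS]addrC addrA subrK.
rewrite r2; apply: le_trans (rnD _ _) _; rewrite rnN lerD ?near //.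
by apply: fsubset_trans AA0 (fsubsetUr _ _).
Qed.

(** A compact operator [K] is nearly of finite rank on [E]. For finite rank
    operators [F], both [T F - F] and [F T - F] are controlled by the defects
    of the finitely many vectors defining [F], because [T] is self-adjoint. *)
Lemma frame_of_defect : bessel ->
  (forall v (r : R), E v -> 0 < r ->
    exists A0, forall A, (A0 `<=` A)%fset -> rn (defect A v) <= r) ->
  is_frame E e.
Proof.
move=> bes small; split=> // K [KE Kapp] eps eps0.
have epsE : (((complex.Re eps)%:C)%C) = eps by rewrite RRe_real // gtr0_real.
set r := complex.Re eps in epsE.
have r0 : 0 < r by rewrite -ltcR epsE.
(* [K] is replaced by [F] at [v] and at [T v], whose norm is at most twice that
   of [v]; the fourth part pays for the defects. *)
pose d := r / 4; have d0 : 0 < d by rewrite divr_gt0.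
have [|n [a [b [Eab FK]]]] := Kapp ((d%:C)%C); first by rewrite ltcR.
pose F v : V := \sum_(i < n) theta (a i) (b i) v.
have EF v : E v -> E (F v).
  move=> Ev; rewrite /F.
  elim/big_ind: _ => [|u w|i _]; [exact: zero_mem Ev|exact: add_mem|].
  by apply: Eact; case: (Eab i).
have {}FK v : E v -> rn (K v - F v) <= d * rn v.
  by move=> /FK; rewrite !normE -rmorphM lecR.
pose M := \sum_(i < n) (rn (a i) + rn (b i)).
have M0 : 0 <= M by apply: sumr_ge0 => i _; rewrite addr_ge0 ?rn_ge0.
pose k := d / (M + 1).
have M1 : 0 < M + 1 by rewrite ltr_wpDl.
have k0 : 0 < k by rewrite divr_gt0.
have kM : k * M <= d.
  by rewrite /k mulrAC ler_pdivrMr // ler_wpM2l ?(ltW d0) // lerDl.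
have [A0 HA0] : exists A0, forall A, (A0 `<=` A)%fset -> forall i,
    rn (defect A (a i)) <= k /\ rn (defect A (b i)) <= k.
  have H i : exists A0, forall A, (A0 `<=` A)%fset ->
      rn (defect A (a i)) <= k /\ rn (defect A (b i)) <= k.
    have [Ea Eb] := Eab i.
    have [A1 H1] := small _ _ Ea k0; have [A2 H2] := small _ _ Eb k0.
    exists (A1 `|` A2)%fset => A; rewrite fsubUset => /andP[A1A A2A].
    by split; [exact: H1|exact: H2].
  have [A_ HA] := choice H.
  exists (\bigcup_(i <- enum 'I_n) A_ i)%fset => A AA i; apply: HA.
  apply: fsubset_trans AA; apply: bigfcup_sup => //.
  by rewrite mem_enum.
exists A0 => // A /HA0 {}HA0 v Ev.
have psE w : summability.partial_sum (fun j => theta (e j) (e j) w) A =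
    frame_op A w by rewrite /frame_op big_seq_fsetE.
rewrite !psE /= !normE -epsE -!rmorphM !lecR.
have FT u w : E u -> E w ->
    (forall i, rn (mdot (b i) u - mdot (b i) w) <= k * rn v) ->
    rn (F u - F w) <= d * rn v.
  move=> Eu Ew H; rewrite /F -sumrB; apply: le_trans (rn_sum _ _ _) _.
  apply: (@le_trans _ _ (\sum_(i < n) (rn (a i) + rn (b i)) * (k * rn v))).
    apply: ler_sum => i _; rewrite /theta -mactBr.
    apply: le_trans (rn_mact Hom _ _) _; rewrite ler_pM ?rn_ge0 //.
    by rewrite lerDl rn_ge0.
  by rewrite -mulr_suml -/M mulrA ler_wpM2r ?rn_ge0 // mulrC.
have v0 := rn_ge0 v.
have Tv := frame_op_mem A Ev; have TvE := rn_frame_op A bes Ev.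
have KT : rn (K (frame_op A v) - F (frame_op A v)) <= d * (2 * rn v).
  by apply: le_trans (FK _ Tv) _; rewrite ler_wpM2l ?(ltW d0).
split; last first.
  have -> : K (frame_op A v) - K v = (K (frame_op A v) - F (frame_op A v)) +
     ((F (frame_op A v) - F v) + (F v - K v)).
    by rewrite addrA !subrKA.
  apply: le_trans (rnD _ _) _; apply: le_trans (lerD KT (rnD _ _)) _.
  rewrite [rn (F v - K v)]rnB.
  have h1 := FK _ Ev.
  have h2 : rn (F (frame_op A v) - F v) <= d * rn v.
    apply: FT => // i; rewrite -mdotBr -opprB -/(defect A v).
    rewrite (add_funN (mdotDr _)) rnN -defect_sym.
    apply: le_trans (rn_mdot Hom _ _) _; rewrite ler_wpM2r //.
    by have [] := HA0 i.
  have rE : r = d * 4 by rewrite /d; field.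
  by rewrite rE; lra.
rewrite rnB -/(defect A (K v)).
have -> : defect A (K v) = defect A (K v - F v) + defect A (F v).
  by rewrite -defectD subrK.
apply: le_trans (rnD _ _) _.
have h1 : rn (defect A (K v - F v)) <= d * rn v.
  apply: le_trans (FK _ Ev); apply: rn_defect => //.
  by apply: sub_mem; [exact: KE|exact: EF].
have h2 : rn (defect A (F v)) <= d * rn v.
  rewrite /F (add_fun_sum (defectD A)); apply: le_trans (rn_sum _ _ _) _.
  apply: (@le_trans _ _ (\sum_(i < n) (rn (a i) + rn (b i)) * (k * rn v))).
    apply: ler_sum => i _; rewrite /theta defect_act.
    apply: le_trans (rn_mact Hom _ _) _.
    have [ha _] := HA0 i.
    apply: le_trans (ler_pM (rn_ge0 _) (rn_ge0 _) ha (rn_mdot Hom _ _)) _.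
    rewrite mulrCA; apply: ler_wpM2r; last by rewrite lerDr rn_ge0.
    by rewrite mulr_ge0 // ltW.
  by rewrite -mulr_suml -/M mulrA ler_wpM2r ?rn_ge0 // mulrC.
have rE : r = d * 4 by rewrite /d; field.
by rewrite rE; nra.
Qed.


(** Pointwise convergence of the frame operators to the identity at [v]. *)
Definition defect_vanishes v := forall r : R, 0 < r ->
  exists A0, forall A, (A0 `<=` A)%fset -> rn (defect A v) <= r.

Definition vanishing : set V := [set v | E v /\ defect_vanishes v].

Lemma vanishing_lin k u v :
  vanishing u -> vanishing v -> vanishing (k *: u + v).
Proof.
move=> [Eu Hu] [Ev Hv]; split=> [|r r0]; first exact: Elin.
pose m := complex.Re `|k| + 1.
have k0 : 0 <= complex.Re `|k| by exact: (@rn_ge0 _ (R[i]^o) k).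
have m0 : 0 < m by rewrite ltr_wpDl.
have r1 : 0 < r / 2 / m by rewrite !divr_gt0.
have [A1 H1] := Hu _ r1; have [|A2 H2] := Hv (r / 2); first by rewrite divr_gt0.
exists (A1 `|` A2)%fset => A; rewrite fsubUset => /andP[/H1 h1 /H2 h2].
rewrite defectD defectZ; apply: le_trans (rnD _ _) _; rewrite rnZ.
have -> : r = m * (r / 2 / m) + r / 2 by field; apply: lt0r_neq0.
by apply: lerD => //; apply: ler_pM; rewrite ?rn_ge0 // lerDl.
Qed.

(** Strict convergence, tested on the compact operator [theta u w]. *)
Lemma theta_vanishing u w v : is_frame E e -> E u -> E w -> E v ->
  vanishing (theta u w v).
Proof.
move=> [_ fr] Eu Ew Ev; split=> [|r r0]; first exact: Eact.
have cpt : compact_op E (theta u w).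
  split=> [u' _|eps eps0]; first exact: Eact.
  exists 1%N, (fun=> u), (fun=> w); split=> // u' _.
  by rewrite big_ord1 subrr normr0 mulr_ge0 // ltW.
have m0 : 0 < rn v + 1 by rewrite ltr_wpDl ?rn_ge0.
have [|A0 _ HA] := fr _ cpt (((r / (rn v + 1))%:C)%C).
  by rewrite ltcR divr_gt0.
exists A0 => A /HA/(_ _ Ev)[+ _] /=.
have -> : summability.partial_sum (fun j => theta (e j) (e j) (theta u w v)) A =
  frame_op A (theta u w v) by rewrite /frame_op big_seq_fsetE.
rewrite !normE -rmorphM lecR rnB => /le_trans; apply.
by rewrite mulrAC ler_pdivrMr // ler_wpM2l ?(ltW r0) // lerDl.
Qed.

(** The partial sums of the Parseval series increase, so each is bounded by the
    limit. *)
Lemma vanishing_bessel A x v : vanishing v ->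
  \sum_(j <- A) sqx x (mdot (e j) v) <= formx x v v.
Proof.
move=> [Ev Hv]; apply/ler_addgt0Pr => r r0.
have m0 : 0 < rn v + 1 by rewrite ltr_wpDl ?rn_ge0.
have [|A0 HA] := Hv (r / (rn v + 1)); first by rewrite divr_gt0.
apply: le_trans (ler_sum_fset _ (fsubsetUl A A0)) _ => [j|].
  exact: (sq_ge0 Hom).
have := HA _ (fsubsetUr A A0); rewrite ler_pdivlMr // => {}HA.
set A' := (A `|` A0)%fset in HA *.
have : formx x v (- defect A' v) <= r.
  apply: le_trans (Re_om_le Hom _ _) _; apply: le_trans (rn_mdot Hom _ _) _.
  by rewrite rnN mulrC; have := rn_ge0 (defect A' v); have := rn_ge0 v; nra.
by rewrite (add_funN (formDr Hom x v)) form_defect; lra.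
Qed.

Definition shrink (p c : B) : B := c - cmul p c.

(** [v (1 - p)^n] tends to [0] for [p = (v | v)] of norm at most [1]: this is a
    discrete gradient descent, in which the forms [s_k] of the iterates
    decrease and the energy lost at step [k] is at least [s_k]; hence [(n + 1)
    s_n <= sq c]. *)
Lemma iter_energy v : rn v <= 1 -> forall n x c,
  n.+1%:R * formx x (mact v (iter n (shrink (mdot v v)) c))
                    (mact v (iter n (shrink (mdot v v)) c)) +
    sqx x (iter n.+1 (shrink (mdot v v)) c) <= sqx x c.
Proof.
move=> v1 n x c; set p := mdot v v; set f := shrink p.
have v2 : rn v ^+ 2 <= 1 by rewrite -(expr1n R 2) ler_pXn2r ?nnegrE ?rn_ge0.
pose s b := formx x (mact v b) (mact v b).
have s0 b : 0 <= s b by exact: (form_ge0 Hom).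
have sE b : s b = bform omega x b (cmul p b).
  by rewrite /s /form mdot_act mdot_actl -cmulA /bform.
have sqp b : sqx x (cmul p b) <= s b.
  rewrite -mdot_act; apply: le_trans (sq_mdot Hom x _ _) _.
  by rewrite -[leRHS]mul1r; apply: ler_wpM2r v2; exact: s0.
have loss b : s b + sqx x (f b) <= sqx x b.
  have -> : sqx x (f b) = sqx x b - 2 * s b + sqx x (cmul p b).
    rewrite -![sqx x _]/(bform omega x _ _) /f /shrink (bformBl Hom).
    rewrite !(bformC Hom x _ (_ - _)) !(bformBl Hom) (bformC Hom x _ b) -sE.
    by ring.
  by have := sqp b; lra.
have decr b : s (f b) <= s b.
  have cross : formx x (mact v b) (mact v (cmul p b)) = sqx x (cmul p b).
    rewrite /form mdot_act mdot_actl -!cmulA -/p /sq cadjM cmulA.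
    by rewrite /p -mdot_adj !cmulA.
  have -> : s (f b) = s b - 2 * sqx x (cmul p b) + s (cmul p b).
    rewrite /s /f /shrink mactBr (formBr Hom) !(formBl Hom) cross (formC Hom).
    rewrite cross.
    by ring.
  have : s (cmul p b) <= sqx x (cmul p b).
    apply: le_trans (vsq_act Hom _ _ _) _; rewrite -[leRHS]mul1r.
    by apply: ler_wpM2r v2; exact: (sq_ge0 Hom).
  by have := sq_ge0 Hom x (cmul p b); lra.
elim: n => [|n IH]; first by rewrite mul1r; exact: loss.
apply: le_trans IH; rewrite [iter n.+2 f c]iterS.
have := loss (iter n.+1 f c); have := decr (iter n f c); rewrite -iterS.
set y := iter n.+1 f c; rewrite -/(s y) -/(s (iter n f c)).
rewrite [n.+2%:R]mulrSr; have : 0 <= n.+1%:R :> R by exact: ler0n.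
by have := s0 y; nra.
Qed.

Lemma mact_iter v p n c :
  mact (iter n (fun w : V => w - mact w p) v) c = mact v (iter n (shrink p) c).
Proof.
elim: n c => [//|n IH] c.
by rewrite iterS mactBl -mactA -mactBr IH -iterSr.
Qed.

(** For [p = (v | v)], the vectors [v - v (1 - p)^n] are sums of vectors [w (v
    | v)] and approximate [v]; rescaling removes the bound on the norm of [v].
    *)
Lemma vanishing_dense v : is_frame E e -> E v -> closure vanishing v.
Proof.
move=> fr Ev0.
have small w : E w -> rn w <= 1 -> closure vanishing w.
  move=> Ew w1; set p := mdot w w.
  pose xi n := iter n (fun u : V => u - mact u p) w.
  have Exi n : E (xi n).
    by elim: n => [//|n IH]; rewrite /xi iterS; apply: sub_mem; [|exact: Eact].
  have Vxi n : vanishing (w - xi n).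
    elim: n => [|n IH].
      have T := theta_vanishing fr Ew Ew Ew; have := vanishing_lin (-1) T T.
      by rewrite scaleN1r addNr /xi /= subrr.
    have -> : w - xi n.+1 = 1 *: theta (xi n) w w + (w - xi n).
      by rewrite /xi iterS scale1r opprB addrCA.
    by apply: vanishing_lin => //; exact: theta_vanishing.
  apply/closure_rnP => r r0; have r2 : 0 < r ^+ 2 by exact: exprn_gt0.
  pose n := Num.bound (r ^+ 2)^-1; exists (w - xi n) => //.
  rewrite subKr -(ltr_pXn2r (n := 2)) ?nnegrE ?rn_ge0 ?(ltW r0) //.
  have n0 : 0 < n.+1%:R :> R by rewrite ltr0n.
  apply: (@le_lt_trans _ _ (n.+1%:R^-1)).
    apply: (vnorming Hom) => [|x c]; first by rewrite invr_ge0 ltW.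
    rewrite mact_iter mulrC ler_pdivlMr // mulrC.
    apply: le_trans (iter_energy w1 n x c).
    by rewrite lerDl; exact: (sq_ge0 Hom).
  rewrite invf_plt ?posrE //; apply: (@lt_le_trans _ _ n%:R).
    by apply: archi_boundP; rewrite invr_ge0 ltW.
  by rewrite ler_nat.
have m0 : 0 < rn v + 1 by rewrite ltr_wpDl ?rn_ge0.
pose k := (((rn v + 1)^-1)%:C)%C : R[i]; pose k' := ((rn v + 1)%:C)%C : R[i].
have kk : k' * k = 1 by rewrite -rmorphM divff ?rmorph1 // gt_eqF.
have normR (a : R) : 0 < a -> complex.Re `|(a%:C)%C| = a.
  by move=> a0; rewrite ger0_norm // ler0c ltW.
have kv1 : rn (k *: v) <= 1.
  by rewrite rnZ normR ?invr_gt0 // mulrC ler_pdivrMr // mul1r lerDl.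
have /closure_rnP Hk := small _ (scale_mem k Ev0) kv1.
apply/closure_rnP => r r0; have [|w [Ew Hw] kw] := Hk (r / (rn v + 1)).
  by rewrite divr_gt0.
exists (k' *: w).
  have W : vanishing w by [].
  have := vanishing_lin k' W (vanishing_lin (-1) W W).
  by rewrite scaleN1r addNr addr0.
have -> : v - k' *: w = k' *: (k *: v - w).
  by rewrite scalerBr scalerA kk scale1r.
by rewrite rnZ normR // mulrC -ltr_pdivlMr.
Qed.

(** The bound holds on the dense subspace where the frame operators converge,
    and each of its finite sums is continuous. *)
Lemma frame_bessel : is_frame E e -> bessel.
Proof.
move=> fr A x v Ev.
apply: (quad_closure (quad_frame_sum x A) (quad_vsq Hom V x) _
         (vanishing_dense fr Ev)) => s.
exact: vanishing_bessel.
Qed.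

Lemma frame_vanishing v : is_frame E e -> E v -> vanishing v.
Proof.
move=> fr Ev; split=> // r r0; have bes := frame_bessel fr.
have r2 : 0 < r / 2 by rewrite divr_gt0.
have /closure_rnP/(_ _ r2)[w [Ew Hw] vw] := vanishing_dense fr Ev.
have [A0 HA] := Hw _ r2; exists A0 => A /HA h.
have -> : defect A v = defect A (v - w) + defect A w.
  by rewrite -defectD subrK.
apply: le_trans (rnD _ _) _; rewrite (splitr r) lerD //.
by apply: le_trans (ltW vw); apply: rn_defect => //; exact: sub_mem.
Qed.

(** Pairing the frame operators at [v] with [v] gives the partial sums of the
    Parseval series, in the algebra and in every localisation; conversely the
    convergence of these sums makes the defects small. *)
Lemma frame_parseval :
  is_frame E e <->
  ((forall v, E v -> in_ell2 (fun j => mdot (e j) v)) /\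
   (forall x v, E v ->
     (\esum_(j in setT) (sqx x (mdot (e j) v))%:E = (formx x v v)%:E)%E)).
Proof.
split=> [fr|[ell pars]].
  split=> [v Ev|x v Ev].
    have [_ Hv] := frame_vanishing fr Ev.
    apply/cvg_ex; exists (mdot v v); apply/totally_cvgP => r r0.
    have m0 : 0 < rn v + 1 by rewrite ltr_wpDl ?rn_ge0.
    have [|A0 HA] := Hv (r / 2 / (rn v + 1)); first by rewrite !divr_gt0.
    exists A0 => A /HA h.
    have -> : summability.partial_sum
        (fun j => cmul (cadj (mdot (e j) v)) (mdot (e j) v)) A =
        mdot v (frame_op A v) by rewrite mdot_frame_op big_seq_fsetE.
    rewrite -mdotBr -/(defect A v); apply: le_lt_trans (rn_mdot Hom _ _) _.
    move: h; rewrite ler_pdivlMr // => h.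
    by have := rn_ge0 (defect A v); have := rn_ge0 v; nra.
  have [_ Hv] := frame_vanishing fr Ev.
  apply: (esum_eq_fset (F := fun j => sqx x (mdot (e j) v))) => [A _|r r0].
    exact: frame_bessel.
  have m0 : 0 < rn v + 1 by rewrite ltr_wpDl ?rn_ge0.
  have [|A0 HA] := Hv (r / (rn v + 1)); first by rewrite divr_gt0.
  exists A0 => //; have := HA _ (fsubset_refl _).
  rewrite ler_pdivlMr // => h; rewrite -lerBlDl -form_defect.
  apply: le_trans (Re_om_le Hom _ _) _; apply: le_trans (rn_mdot Hom _ _) _.
  by rewrite mulrC; have := rn_ge0 (defect A0 v); have := rn_ge0 v; nra.
have bes : bessel.
  move=> A x v Ev; rewrite -lee_fin -pars //.
  exact: (fset_le_esum (fun j => sqx x (mdot (e j) v))).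
apply: frame_of_defect => // v r Ev r0.
by apply: defect_small => //; exact: ell.
Qed.

End Bessel.
End FrameOperator.

(** * Functions with compact support *)

Section Topology.
Implicit Types S T : topologicalType.

Lemma injective_hausdorff S T (f : S -> T) :
  continuous f -> injective f -> hausdorff_space T -> hausdorff_space S.
Proof.
move=> cf fI hT p q pq; apply/fI/hT => A B /cf Ap /cf Bq.
by have [s [As Bs]] := pq _ _ Ap Bq; exists (f s).
Qed.

Lemma compact_cover_compact S (K : set S) : compact K -> cover_compact K.
Proof.
have [-> _ I D f _ _|/set0P[a Ka] cK] := eqVneq K set0.
  by exists fset0.
pose isP := isPointed.Build S a.
pose S' : ptopologicalType := HB.pack S isP.
by move: cK; rewrite -[compact K]/(@compact S' K) compact_cover.
Qed.

Definition locally_injective S T (f : S -> T) :=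
  forall a, exists U,
    [/\ open U, U a & forall b c, U b -> U c -> f b = f c -> b = c].

(** Open sets on which [f] is injective meet the fibre in at most one point,
    and finitely many of them cover the compact set. *)
Lemma finite_fibre S T (f : S -> T) (K : set S) x :
  continuous f -> closed [set x] -> locally_injective f -> compact K ->
  finite_set (K `&` [set a | f a = x]).
Proof.
move=> cf clx finj cK; have [U HU] := choice finj.
have cK' : compact (K `&` [set a | f a = x]).
  apply: compact_closedI => //.
  by apply: (@preimage_closed _ _ f [set x]) => // ? _; exact: cf.
have /(_ _ (K `&` [set a | f a = x]) U) := compact_cover_compact cK'.
case=> [a _|a Ka|D' D'K cov]; first by case: (HU a).
  by exists a => //; case: (HU a).
apply: (sub_finite_set _ (finite_fset D')) => b Kb.
have [i iD Uib] := cov _ Kb; have [_ Uii inj] := HU i.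
have := D'K _ iD; rewrite inE => -[_ fi].
by rewrite (inj b i Uib Uii) // fi; case: Kb.
Qed.

End Topology.

Section CompactSupport.
Context (R : realType).
Implicit Type T : topologicalType.

Lemma continuous_complexP T (f : T -> R[i]) :
  continuous (f : T -> R[i]^o) <->
  forall t (r : R), 0 < r -> \forall s \near t, rn (f t - f s : R[i]^o) < r.
Proof.
split=> [cf t r r0|H t].
  have rC : 0 < (r%:C)%C :> R[i] by rewrite ltcR.
  have /cvgrPdist_lt/(_ _ rC) := cf t.
  by apply: filterS => s; rewrite normE ltcR.
apply/cvgrPdist_lt => d d0.
have dE : ((complex.Re d)%:C)%C = d by rewrite RRe_real // gtr0_real.
have := H t (complex.Re d); rewrite -ltcR dE => /(_ d0).
by apply: filterS => s ts; rewrite normE -dE ltcR.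
Qed.

Lemma rn_complexM (z w : R[i]^o) : rn (z * w : R[i]^o) = rn z * rn w.
Proof. exact: (rnZ (z : R[i]) w). Qed.

Lemma rn_conj (z : R[i]) : rn (z^* : R[i]^o) = rn (z : R[i]^o).
Proof. by rewrite /rn norm_conjC. Qed.

Lemma Re_rn (z : R[i]) : `|complex.Re z| <= rn (z : R[i]^o).
Proof.
case: z => a b; rewrite /rn normc_def /= -sqrtr_sqr ler_wsqrtr //.
by rewrite lerDl sqr_ge0.
Qed.

Lemma Im_rn (z : R[i]) : `|complex.Im z| <= rn (z : R[i]^o).
Proof.
case: z => a b; rewrite /rn normc_def /= -sqrtr_sqr ler_wsqrtr //.
by rewrite lerDr sqr_ge0.
Qed.

Lemma rn_realC (r : R) : rn ((r%:C)%C : R[i]^o) = `|r|.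
Proof. by rewrite /rn normc_def /= expr0n /= addr0 sqrtr_sqr. Qed.

Lemma continuous_Re T (f : T -> R[i]) : continuous (f : T -> R[i]^o) ->
  continuous (fun t => complex.Re (f t)).
Proof.
move=> /continuous_complexP cf t; apply/cvgrPdist_lt => r /(cf t).
apply: filterS => s /(le_lt_trans _); apply.
by rewrite -ReB Re_rn.
Qed.

Lemma continuous_Im T (f : T -> R[i]) : continuous (f : T -> R[i]^o) ->
  continuous (fun t => complex.Im (f t)).
Proof.
move=> /continuous_complexP cf t; apply/cvgrPdist_lt => r /(cf t).
apply: filterS => s /(le_lt_trans _); apply.
have <- : complex.Im (f t - f s) = complex.Im (f t) - complex.Im (f s).
  by case: (f t) (f s) => [? ?] [? ?].
exact: Im_rn.
Qed.

Lemma continuous_realC T (f : T -> R) : continuous f ->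
  continuous ((fun t => ((f t)%:C)%C) : T -> R[i]^o).
Proof.
move=> cf; apply/continuous_complexP => t r r0.
have /cvgrPdist_lt/(_ _ r0) := cf t.
by apply: filterS => s; rewrite -rmorphB rn_realC.
Qed.

Lemma Cc_linear T (k : R[i]) (f g : T -> R[i]) : Cc f -> Cc g ->
  Cc (fun t => k * f t + g t).
Proof.
move=> [/continuous_complexP cf Kf] [/continuous_complexP cg Kg]; split.
  apply/continuous_complexP => t r r0.
  pose m := rn (k : R[i]^o) + 1.
  have m0 : 0 < m by rewrite ltr_wpDl ?rn_ge0.
  have r1 : 0 < r / 2 / m by rewrite !divr_gt0.
  have r2 : 0 < r / 2 by rewrite divr_gt0.
  apply: filterS2 (cf t _ r1) (cg t _ r2) => s h1 h2.
  have -> : k * f t + g t - (k * f s + g s) = k * (f t - f s) + (g t - g s).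
    by ring.
  apply: le_lt_trans (rnD _ _) _; rewrite rn_complexM.
  have -> : r = m * (r / 2 / m) + r / 2 by field; apply: lt0r_neq0.
  rewrite ler_ltD // ler_pM ?rn_ge0 ?(ltW h1) // lerDl //.
apply: (subclosed_compact _ (compactU Kf Kg)); first exact: closed_closure.
rewrite -closureU; apply: closure_subset => t /= H.
have [ft|] := eqVneq (f t) 0; last by left.
by right; apply: contra_neq H => gt; rewrite ft gt mulr0 addr0.
Qed.

Lemma Cc0 T : Cc (fun _ : T => 0 : R[i]).
Proof.
split.
  by apply/continuous_complexP => t r r0; near=> s; rewrite subrr rn0.
rewrite [X in closure X](_ : _ = set0) ?closure0; first exact: compact0.
by apply/seteqP; split=> t //=; rewrite eqxx.
Unshelve. all: by end_near. Qed.

Lemma Cc_sum T (I : eqType) (r : seq I) (c : I -> R[i]) (g : I -> T -> R[i]) :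
  (forall i, i \in r -> Cc (g i)) -> Cc (fun t => \sum_(i <- r) c i * g i t).
Proof.
elim: r => [_|i r IH H].
  by rewrite (_ : (fun _ => _) = fun=> 0);
    [exact: Cc0|apply/funext => t; rewrite big_nil].
rewrite (_ : (fun _ => _) = fun t => c i * g i t + \sum_(j <- r) c j * g j t).
  apply: Cc_linear; first by apply: H; rewrite mem_head.
  by apply: IH => j jr; apply: H; rewrite inE jr orbT.
by apply/funext => t; rewrite big_cons.
Qed.

(** Complete regularity separates [a] from the complement of a relatively
    compact neighbourhood of [a] inside [U]. *)
Lemma bump T (U : set T) a : locally_compact [set: T] -> hausdorff_space T ->
  open U -> U a ->
  exists g : T -> R[i], [/\ Cc g, g a = 1 & forall b, ~ U b -> g b = 0].
Proof.
move=> lcT hT oU Ua.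
have [N] := lcT a I; rewrite withinET => Na [cN clN].
pose V := N^° `&` U.
have oV : open V by apply: openI => //; exact: open_interior.
have Va : V a by split=> //; rewrite /interior.
have sep : uniform_separator [set a] (~` V).
  apply: (@locally_compact_completely_regular T R lcT hT).
    by rewrite closedC.
  exact.
have [f [cf _ fa fV]] := iffLR (@uniform_separatorP T R _ _) sep.
have fa0 : f a = 0 by apply: fa; exists a.
have fV1 b : ~ V b -> f b = 1 by move=> Vb; apply: fV; exists b.
exists (fun t => ((1 - f t)%:C)%C); split; last 2 first.
- by rewrite fa0 subr0.
- by move=> b Ub; rewrite fV1 ?subrr // => -[].
split.
  apply: (@continuous_realC T (fun t => 1 - f t)) => t.
  by apply: cvgB; [exact: cvg_cst|exact: cf].
apply: (subclosed_compact _ cN); first exact: closed_closure.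
rewrite [X in _ `<=` X](closure_id N).1 //; apply: closure_subset => t /= ft.
apply: contrapT => Nt; move/eqP: ft; apply; rewrite fV1 ?subrr // => -[It _].
exact: (Nt (interior_subset It)).
Qed.

End CompactSupport.

(** * Etale groupoids *)

Lemma esum_finsupp (R : realType) (I : choiceType) (D : set I) (F : I -> R)
    (A : {fset I}) : (forall i, 0 <= F i) -> [set` A] `<=` D ->
  (forall i, D i -> i \notin A -> F i = 0) ->
  (\esum_(i in D) (F i)%:E = (\sum_(i <- A) F i)%:E)%E.
Proof.
move=> F0 AD FA; apply: (esum_eq_fset (F := F)) => [A' A'D|r r0].
  rewrite (@big_fset_incl _ _ _ _ A (A `|` A')%fset) ?fsubsetUl // => [|i].
    by apply: ler_sum_fset; rewrite ?fsubsetUr.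
  by rewrite inE => /orP[->//|/A'D Di]; exact: FA.
by exists A => //; rewrite lerDl ltW.
Qed.

Lemma fsbig_finsupp (V : nmodType) (I : choiceType) (D : set I) (F : I -> V)
    (A : {fset I}) : [set` A] `<=` D ->
  (forall i, D i -> i \notin A -> F i = 0) ->
  \sum_(i \in D) F i = \sum_(i <- A) F i.
Proof.
move=> AD FA; rewrite -(fsbig_widen [set` A]) //.
  by rewrite fsbig_finite //= set_fsetK.
by move=> i [Di /negP]; exact: FA.
Qed.

Section GroupoidAlgebra.
Context (G0 G : topologicalType) (GG : groupoid G0 G).

Lemma inv_invK a : inv GG (inv GG a) = a.
Proof.
rewrite -[LHS](mul_untr GG) src_inv rng_inv -inv_mul mul_assoc ?src_inv //.
by rewrite inv_mul src_inv mul_untl.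
Qed.

Lemma inv_unt u : inv GG (unt GG u) = unt GG u.
Proof.
by rewrite -[LHS](mul_untr GG) src_inv rng_unt inv_mul src_unt.
Qed.

Lemma inv_inj : injective (inv GG).
Proof. exact: can_inj inv_invK. Qed.

Lemma unt_inj : injective (unt GG).
Proof. exact: can_inj (rng_unt GG). Qed.

Lemma units_hausdorff : hausdorff_space G0.
Proof.
exact: injective_hausdorff (@unt_cont _ _ GG) unt_inj (groupoid_hausdorff GG).
Qed.

Lemma units_closed1 (u : G0) : closed [set u].
Proof.
apply: accessible_closed_set1; apply: hausdorff_accessible.
exact: units_hausdorff.
Qed.

Hypothesis Get : etale GG.

Lemma etale_rng : locally_injective (rng GG).
Proof.
move=> a; have [U [oU Ua _ [[_ inj _] _]]] := Get a; exists U; split=> // b c.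
by move=> Ub Uc; apply: inj; rewrite inE.
Qed.

Lemma etale_src : locally_injective (src GG).
Proof.
move=> a; have [U [oU Ua inj]] := etale_rng (inv GG a).
exists (inv GG @^-1` U); split=> //.
  by apply: open_comp => // ? _; exact: inv_cont.
by move=> b c Ub Uc bc; apply/inv_inj/inj; rewrite // !rng_inv.
Qed.

(** If [r] is injective on [U], a point [b] of [U] with [unt (r b)] in [U]
    coincides with this unit. *)
Lemma etale_units_open : open (range (unt GG)).
Proof.
rewrite openE => _ [u _ <-]; have [U [oU Uu inj]] := etale_rng (unt GG u).
rewrite /interior nbhsE; exists (U `&` (unt GG \o rng GG) @^-1` U).
  split; last by split; rewrite //= rng_unt.
  apply: openI => //; apply: open_comp => // ? _.
  by apply: continuous_comp; [exact: rng_cont|exact: unt_cont].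
by move=> b [Ub Urb]; exists (rng GG b) => //; apply: inj; rewrite ?rng_unt.
Qed.

Context (R : realType).
Implicit Types f g : G -> R[i].

Lemma Cc_src_finite f x : Cc f ->
  finite_set [set a | src GG a = x /\ f a != 0].
Proof.
move=> [_ Kf].
have fin :=
  finite_fibre (@src_cont _ _ GG) (units_closed1 (u := x)) etale_src Kf.
apply: (sub_finite_set _ fin) => a [ax fa]; split=> //.
exact: subset_closure.
Qed.

Lemma Cc_rng_finite f x : Cc f ->
  finite_set [set a | rng GG a = x /\ f a != 0].
Proof.
move=> [_ Kf].
have fin :=
  finite_fibre (@rng_cont _ _ GG) (units_closed1 (u := x)) etale_rng Kf.
apply: (sub_finite_set _ fin) => a [ax fa]; split=> //.
exact: subset_closure.
Qed.

(** The point [a] is isolated in its source fibre. *)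
Lemma src_bump a : exists g : G -> R[i],
  [/\ Cc g, g a = 1 & forall b, src GG b = src GG a -> b <> a -> g b = 0].
Proof.
have [U [oU Ua inj]] := etale_src a.
have [g [Cg ga gU]] :=
  bump R (@groupoid_lc _ _ GG) (@groupoid_hausdorff _ _ GG) oU Ua.
exists g; split=> // b ba ne; apply: gU => Ub; apply: ne.
exact: inj.
Qed.

Lemma src_interpolation x (A : {fset G}) (psi : G -> R[i]) :
  [set` A] `<=` [set a | src GG a = x] ->
  exists2 g : G -> R[i], Cc g &
    forall a, src GG a = x -> g a = if a \in A then psi a else 0.
Proof.
move=> Ax; have [beta Hb] := choice src_bump.
exists (fun t => \sum_(b <- A) psi b * beta b t).
  by apply: Cc_sum => b _; case: (Hb b).
move=> a ax; have beta0 b : b \in A -> b != a -> psi b * beta b a = 0.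
  move=> bA ba; have [_ _ H] := Hb b; rewrite H ?mulr0 ?ax //.
    by rewrite (Ax b bA).
  by move=> ab; rewrite ab eqxx in ba.
case: ifP => aA; last first.
  rewrite big_seq big1 // => b bA; apply: beta0 => //.
  by apply: contraFneq aA => <-.
rewrite (big_fsetD1 a aA) /= big_seq big1 ?addr0 => [|b].
  by have [_ -> _] := Hb a; rewrite mulr1.
by rewrite !inE => /andP[ba bA]; exact: beta0.
Qed.

Lemma Cc_invol f : Cc f -> Cc (invol GG f).
Proof.
move=> [cf Kf]; split.
  apply/continuous_complexP => a r r0; have /continuous_complexP := cf.
  move=> /(_ (inv GG a) r r0) h.
  have : \forall b \near a, rn (f (inv GG a) - f (inv GG b) : R[i]^o) < r.
    exact: (@inv_cont _ _ GG a _ h).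
  by apply: filterS => b; rewrite /invol -rmorphB rn_conj.
have -> : [set t | invol GG f t != 0] = inv GG @` [set t | f t != 0].
  apply/seteqP; split=> [a /= fa|_ [a fa <-]] /=.
    exists (inv GG a); last exact: inv_invK.
    by apply: contra_neq fa; rewrite /invol /= => ->; rewrite conjC0.
  by rewrite /invol inv_invK conjC_eq0.
have cK : compact (inv GG @` closure [set t | f t != 0]).
  apply: continuous_compact => //; apply: continuous_subspaceT.
  exact: inv_cont.
apply: (subclosed_compact _ cK); first exact: closed_closure.
rewrite [X in _ `<=` X](closure_id _).1.
  by apply: closure_subset; apply: image_subset; exact: subset_closure.
by apply: compact_closed => //; exact: groupoid_hausdorff GG.
Qed.

Hypothesis G0c : compact [set: G0].

(** The unit of the convolution algebra. It is continuous because the units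
    form an open and compact set. *)
Definition unit_char (a : G) : R[i] := if `[< range (unt GG) a >] then 1 else 0.

Lemma Cc_unit_char : Cc unit_char.
Proof.
have cK : compact (range (unt GG)).
  apply: continuous_compact => //; apply: continuous_subspaceT.
  exact: unt_cont.
have clK : closed (range (unt GG)).
  by apply: compact_closed => //; exact: groupoid_hausdorff GG.
split.
  apply/continuous_complexP => a r r0; rewrite /unit_char; case: asboolP => Ua.
    apply: filterS (open_nbhs_nbhs (conj etale_units_open Ua)) => b Ub.
    by case: asboolP => // _; rewrite subrr rn0.
  have oC : open (~` range (unt GG)) by rewrite openC.
  apply: filterS (open_nbhs_nbhs (conj oC Ua)) => b Ub.
  by case: asboolP => // _; rewrite subrr rn0.
apply: (subclosed_compact _ cK); first exact: closed_closure.
rewrite [X in _ `<=` X](closure_id _).1 //; apply: closure_subset => a /=.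
by rewrite /unit_char; case: asboolP => //; rewrite eqxx.
Qed.

Lemma conv_unit_char f : conv GG unit_char f = f.
Proof.
apply/funext => a; rewrite /conv.
rewrite (fsbig_finsupp (A := [fset unt GG (rng GG a)]%fset)).
- by rewrite big_seq_fset1 inv_unt mul_untl /unit_char asboolT ?mul1r.
- by move=> b /=; rewrite inE => /eqP ->; rewrite rng_unt.
move=> b ba; rewrite inE /unit_char; case: asboolP => [[u _ ub]|_ _].
  by rewrite -ba -ub rng_unt eqxx.
by rewrite mul0r.
Qed.

End GroupoidAlgebra.

(** * The states of evaluation at units of the reduced C*-algebra *)

Section ReducedStates.
Context (R : realType) (H0 H : topologicalType) (HH : groupoid H0 H)
  (Het : etale HH) (Hcompact : compact [set: H0])
  (B : cstar_algebra R) (iota : (H -> R[i]) -> B)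
  (Hred : is_reduced_cstar HH iota)
  (omega : H0 -> B -> R[i]) (Hst : forall x, is_state (omega x))
  (HCc : forall x f, Cc f -> omega x (iota f) = f (unt HH x)).
Implicit Types (x : H0) (f g : H -> R[i]) (a : H) (b c : B).

Local Notation sqx x := (sq (omega x)).

Lemma iotaB f g : Cc f -> Cc g ->
  Cc (fun a => -1 * g a + f a) /\
  iota (fun a => -1 * g a + f a) = iota f - iota g.
Proof.
move=> Cf Cg; split; first exact: Cc_linear.
by rewrite (red_linear Hred) // scaleN1r addrC.
Qed.

Lemma iotaZ k f : Cc f ->
  Cc (fun a => k * f a + 0) /\ iota (fun a => k * f a + 0) = k *: iota f.
Proof.
move=> Cf; split; first exact: Cc_linear Cf (@Cc0 R H).
rewrite (red_linear Hred) //; last exact: Cc0.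
suff -> : iota (fun=> 0) = 0 by rewrite addr0.
have [_] := iotaB Cf Cf; rewrite subrr => <-; congr iota.
by apply/funext => a; rewrite mulN1r addNr.
Qed.

Lemma iota_dense b : closure (iota @` [set f | Cc f]) b.
Proof. by rewrite (red_dense Hred). Qed.

Lemma iota_approx b (r : R) : 0 < r ->
  exists2 f, Cc f & rn (b - iota f) < r.
Proof.
have /closure_rnP h := @iota_dense b.
by move=> /h[_ [f Cf <-]] ?; exists f.
Qed.

Lemma abs2_le (z : R[i]) (r : R) : `|z| <= ((r%:C)%C) -> abs2 z <= r ^+ 2.
Proof.
have n0 : 0 <= complex.Re `|z| by exact: (@rn_ge0 _ (R[i]^o) z).
move=> zr; have {}zr : complex.Re `|z| <= r.
  by rewrite -lecR (RRe_real (normr_real z)).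
by rewrite abs2E ler_pXn2r ?nnegrE // (le_trans n0).
Qed.

(** By density, since units are fixed by inversion. *)
Lemma state_adj x b : omega x (cadj b) = (omega x b)^*.
Proof.
have omD (u v : B) : omega x (u + v) = omega x u + omega x v.
  by have := state_linear (Hst x) 1 u v; rewrite scale1r mul1r.
have ab2 (z : R[i]) : abs2 z = 0 -> z = 0.
  case: z => p q /eqP; rewrite /abs2 /= paddr_eq0 ?sqr_ge0 // !sqrf_eq0.
  by move=> pq; apply/eqP; rewrite eq_complex.
apply/eqP; rewrite -subr_eq0; apply/eqP/ab2.
pose F c := abs2 (omega x (cadj c) - (omega x c)^*).
have qF : quad F.
  apply: (@quad_abs2 _ _ _ 4) => [u v|u].
    by rewrite cadjD !omD rmorphD opprD addrACA.
  rewrite (_ : 4 * rn u ^+ 2 = (2 * rn u) ^+ 2); last by ring.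
  apply: abs2_le; apply: le_trans (ler_normB _ _) _.
  rewrite norm_conjC mulr_natl mulr2n rmorphD.
  apply: lerD; apply: le_trans (state_le (Hst x) _) _; rewrite normE.
    by rewrite rn_cadj; exact: lexx.
  exact: lexx.
apply: (quad_closure0 qF _ (@iota_dense b)) => _ [f Cf <-].
rewrite /F -(red_adj Hred) // !HCc //; last exact: Cc_invol.
by rewrite /invol inv_unt subrr /abs2 /= !expr0n addr0.
Qed.

Lemma reduced_contractive : contractive_states omega.
Proof.
split.
- by move=> x; exact: state_linear (Hst x).
- by move=> x; exact: state_pos (Hst x).
- exact: state_adj.
- by move=> x; exact: state_le (Hst x).
Qed.

Local Notation Hc := reduced_contractive.

(** In the GNS space of the state at [x], the function [f] is its restriction
    to the fibre of the source map over [x]. *)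
Lemma state_dot x f g : Cc f -> Cc g ->
  omega x (cmul (cadj (iota g)) (iota f)) =
  \sum_(a \in [set a | src HH a = x]) (g a)^* * f a.
Proof.
move=> Cf Cg; have Cg' := Cc_invol HH Cg.
rewrite -(red_adj Hred) //; have [Cgf <-] := red_mul Hred Cg' Cf.
rewrite HCc // /conv.
rewrite (@reindex_fsbig _ _ _ _ _ (inv HH) [set a | src HH a = x]
  [set b | rng HH b = rng HH (unt HH x)]).
  apply: eq_fsbigr => a; rewrite inE /= => ax.
  by rewrite /invol inv_invK -ax mul_untr.
split=> [a /= ax|a c _ _|b /= bx].
- by rewrite rng_inv rng_unt.
- exact: inv_inj.
- by exists (inv HH b); rewrite ?inv_invK //= src_inv bx rng_unt.
Qed.

Lemma sq_iota x f : Cc f -> l2sq HH x f = (sqx x (iota f))%:E.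
Proof.
move=> Cf; have fin := Cc_src_finite Het x Cf.
set A := fset_set [set a | src HH a = x /\ f a != 0].
have AE a : (a \in A) = `[< src HH a = x /\ f a != 0 >].
  by rewrite /A in_fset_set // inE; apply/idP/asboolP.
have AD : [set` A] `<=` [set a | src HH a = x].
  by move=> a /=; rewrite AE => /asboolP[].
have f0 a : src HH a = x -> a \notin A -> f a = 0.
  move=> ax; rewrite AE => /asboolP h; apply: contrapT => /eqP fa.
  by apply: h.
rewrite /l2sq (esum_finsupp (F := fun a => abs2 (f a)) (A := A)) //; first last.
- by move=> a ax /f0 ->; rewrite // /abs2 /= expr0n addr0.
- by move=> a; exact: abs2_ge0.
congr (_%:E); rewrite /sq state_dot // (fsbig_finsupp AD); last first.
  by move=> a ax /f0 ->; rewrite ?mulr0.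
by rewrite Re_sum; apply: eq_bigr => a _; rewrite conj_abs2.
Qed.

Lemma sq_bound_Cc x f g : Cc f -> Cc g ->
  sqx x (cmul (iota f) (iota g)) <= rn (iota f) ^+ 2 * sqx x (iota g).
Proof.
move=> Cf Cg.
apply: (@le_eps_sq _ _ _ (rn (iota f) ^+ 2)); first exact: sqr_ge0.
(* The function [g] is scaled to norm at most 1; the term [r ^+ 2] covers the
   case where it vanishes on the fibre. *)
move=> r r0; rewrite -mulrDr; set q := sqx x (iota g).
have q0 : 0 <= q by exact: (sq_ge0 Hc).
have m0 : 0 < q + r ^+ 2 by rewrite ltr_wpDl ?exprn_gt0.
pose k := ((Num.sqrt (q + r ^+ 2)^-1)%:C)%C : R[i].
have k2 : abs2 k = (q + r ^+ 2)^-1.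
  by rewrite /abs2 /= expr0n addr0 sqr_sqrtr // invr_ge0 ltW.
have sqZ b : sqx x (k *: b) = abs2 k * sqx x b.
  rewrite /sq cadjZ cmulZl cmulZr !(omZ Hc) mulrA conj_abs2.
  exact: ReZ.
have [CZ ZE] := iotaZ k Cg; set psi := (fun a => _) in CZ ZE.
have le1 : ((rn (iota f) ^+ 2)%:E >= l2sq HH x (conv HH f psi))%E.
  rewrite -Re_rn2 (red_norm Hred) //; apply: ereal_sup_ubound.
  exists x, psi; split=> //; rewrite sq_iota // ZE sqZ lee_fin k2.
  by rewrite mulrC ler_pdivrMr // mul1r lerDl sqr_ge0.
have [Cfp fpE] := red_mul Hred Cf CZ.
move: le1; rewrite sq_iota // fpE ZE cmulZr sqZ k2 lee_fin.
by rewrite mulrC ler_pdivrMr.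
Qed.

Lemma quad_cmulr c x : quad (fun b => sqx x (cmul b c)).
Proof.
apply: (@quad_comp _ _ _ (fun b => cmul b c) _ (rn c)) (quad_sq Hc x).
- by move=> u v; exact: cmulDl.
- exact: rn_ge0.
- by move=> u; rewrite mulrC; exact: rn_cmul.
Qed.

Lemma quad_cmull b x : quad (fun c => sqx x (cmul b c)).
Proof.
apply: (@quad_comp _ _ _ (fun c => cmul b c) _ (rn b)) (quad_sq Hc x).
- by move=> u v; exact: cmulDr.
- exact: rn_ge0.
- by move=> u; exact: rn_cmul.
Qed.

Lemma sq_bound x b c : sqx x (cmul b c) <= rn b ^+ 2 * sqx x c.
Proof.
have qr : quad (fun b => sqx x c * rn b ^+ 2).
  by apply: quad_scale (quad_rn _); exact: (sq_ge0 Hc).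
rewrite mulrC; apply: (quad_closure (quad_cmulr c x) qr _ (@iota_dense b)).
move=> _ [f Cf <-]; rewrite mulrC.
have qc := quad_scale (sqr_ge0 (rn (iota f))) (quad_sq Hc x).
apply: (quad_closure (quad_cmull (iota f) x) qc _ (@iota_dense c)).
by move=> _ [g Cg <-]; exact: sq_bound_Cc.
Qed.

(** The reduced norm is a supremum over all square-summable [psi], but finitely
    many values of a convolution with [f] only depend on finitely many values
    of [psi], so that [psi] may be replaced by an element of [Cc]. *)
Lemma norm_iota_le f (M : R) : 0 <= M -> Cc f ->
  (forall x g, Cc g -> sqx x (cmul (iota f) (iota g)) <= M * sqx x (iota g)) ->
  rn (iota f) ^+ 2 <= M.
Proof.
move=> M0 Cf bd; rewrite -lee_fin -Re_rn2 (red_norm Hred) //.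
apply: ge_ereal_sup => _ [x [psi [psi1 ->]]].
apply: (esum_le_fset (F := fun a => abs2 (conv HH f psi a))) => A Ax.
(* [F] contains the points where the convolution evaluates [psi] on [A]. *)
pose N a := fset_set [set b | rng HH b = rng HH a /\ f b != 0].
have NE a (b : H) : (b \in N a) = `[< rng HH b = rng HH a /\ f b != 0 >].
  rewrite /N (in_fset_set (Cc_rng_finite Het (rng HH a) Cf)).
  by apply/idP/asboolP; rewrite inE.
pose F := (\bigcup_(a <- A) [fset mul HH (inv HH b) a | b in N a])%fset.
have memF a (b : H) : a \in A -> b \in N a -> mul HH (inv HH b) a \in F.
  move=> aA bN; apply/bigfcupP; exists a; first by rewrite aA.
  by apply/imfsetP; exists b.
have Fx : [set` F] `<=` [set a | src HH a = x].
  move=> _ /bigfcupP[a /andP[aA _] /imfsetP[b /= bN ->]].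
  rewrite NE in bN; case/asboolP: bN => ba _.
  by rewrite /= src_mul ?src_inv //; exact: Ax.
have [g Cg gE] := src_interpolation Het psi Fx.
have convE a : a \in A -> conv HH f psi a = conv HH f g a.
  move=> aA; apply: eq_fsbigr => b; rewrite inE /= => ba.
  have [->|fb] := eqVneq (f b) 0; first by rewrite !mul0r.
  have ax : src HH a = x by exact: Ax.
  rewrite gE ?src_mul ?src_inv // memF // NE.
  by apply/asboolP.
have [Cfg fgE] := red_mul Hred Cf Cg.
rewrite -lee_fin; apply: (@le_trans _ _ (l2sq HH x (conv HH f g))).
  rewrite (eq_big_seq (fun a => abs2 (conv HH f g a))) => [|a aA]; last first.
    by rewrite convE.
  exact: (fset_le_esum (fun a => abs2 (conv HH f g a))).
rewrite sq_iota // fgE; apply: (@le_trans _ _ (M * sqx x (iota g))%:E).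
  by rewrite lee_fin bd.
rewrite EFinM -sq_iota //; apply: le_trans (_ : (M%:E * 1 <= _)%E).
  apply: lee_wpmul2l; first by rewrite lee_fin.
  apply: le_trans psi1; apply: le_esum => a ax; rewrite lee_fin gE //.
  by case: ifP => // _; rewrite /abs2 /= expr0n addr0 addr_ge0 ?sqr_ge0.
by rewrite mule1.
Qed.

(** The bound on [b] is inherited by functions near [b], up to an error of the
    order of their distance, by contractivity of the representations. *)
Lemma sq_norming b (M : R) : 0 <= M ->
  (forall x c, sqx x (cmul b c) <= M * sqx x c) -> rn b ^+ 2 <= M.
Proof.
move=> M0 bd; apply: le_weight => // t t0.
pose s := 1 + t^-1; have s0 : 0 <= s by rewrite addr_ge0 ?invr_ge0 ?(ltW t0).
have t1 : 0 <= 1 + t by rewrite addr_ge0 // ltW.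
have K0 : 0 <= (1 + t) * s + s by rewrite addr_ge0 ?mulr_ge0.
apply: (le_eps_sq K0) => r r0; have [f Cf /ltW fb] := iota_approx b r0.
have fb2 : rn (b - iota f) ^+ 2 <= r ^+ 2.
  by rewrite ler_pXn2r ?nnegrE ?rn_ge0 // (ltW r0).
have h1 : rn b ^+ 2 <= (1 + t) * rn (iota f) ^+ 2 + s * r ^+ 2.
  have := quad_add (quad_rn B) (iota f) (b - iota f) t0.
  rewrite addrC subrK => /le_trans; apply.
  by rewrite lerD2l ler_wpM2l.
apply: (le_trans h1).
have -> : (1 + t) ^+ 2 * M + ((1 + t) * s + s) * r ^+ 2 =
   (1 + t) * ((1 + t) * M + s * r ^+ 2) + s * r ^+ 2 by ring.
rewrite lerD2r ler_wpM2l //; apply: norm_iota_le => // [|x g Cg].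
  by apply: addr_ge0; apply: mulr_ge0 => //; exact: sqr_ge0.
have := quad_add (quad_cmulr (iota g) x) b (iota f - b) t0.
rewrite addrC subrK => /le_trans; apply; rewrite [leRHS]mulrDl lerD //.
  by rewrite -[leRHS]mulrA ler_wpM2l.
rewrite -[leRHS]mulrA ler_wpM2l //; apply: le_trans (sq_bound _ _ _) _.
by rewrite ler_wpM2r ?(sq_ge0 Hc) // rnB.
Qed.

Lemma reduced_norming : norming_states omega.
Proof. by split; [exact: Hc|exact: sq_bound|exact: sq_norming]. Qed.

(** The classes of the [beta a] are an orthonormal basis of the GNS space: the
    coefficients of a function are its values on the source fibre, and
    functions are dense. *)
Lemma state_parseval x (beta : H -> H -> R[i]) :
  (forall a, [/\ Cc (beta a), beta a a = 1 &
     forall a', src HH a' = src HH a -> a' <> a -> beta a a' = 0]) ->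
  forall b, (\esum_(a in [set a | src HH a = x])
    (abs2 (omega x (cmul (cadj (iota (beta a))) b)))%:E = (sqx x b)%:E)%E.
Proof.
move=> Hb b.
pose F a b := abs2 (omega x (cmul (cadj (iota (beta a))) b)).
have qF a : quad (F a).
  apply: (@quad_abs2 _ _ _ (rn (iota (beta a)) ^+ 2)) => [u v|u].
    by rewrite cmulDr (omD Hc).
  rewrite -exprMn; apply: abs2_le; apply: le_trans (state_le (Hst x) _) _.
  by rewrite normE lecR; apply: le_trans (rn_cmul _ _) _; rewrite rn_cadj.
apply: (parseval_closure (F := F) qF (quad_sq Hc x) _ _ (@iota_dense b)).
  move=> _ _ [f Cf <-] [g Cg <-]; have [Cfg fgE] := iotaB Cf Cg.
  by exists (fun a => -1 * g a + f a).
move=> _ [f Cf <-]; rewrite -sq_iota //; apply: eq_esum => a /= ax.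
have [Cb ba b0] := Hb a; rewrite /F state_dot //.
rewrite (fsbig_finsupp (A := [fset a]%fset)); last 2 first.
- by move=> a' /=; rewrite inE => /eqP ->.
- move=> a' /= cx; rewrite inE => /eqP ca.
  by rewrite b0 ?ax // conjC0 mul0r.
by rewrite big_seq_fset1 ba conjC1 mul1r.
Qed.

(** The unit space is compact and open, so its indicator is a unit; this places
    the generators of a submodule inside it. *)
Lemma reduced_unit : exists one : B, forall b, cmul b one = b.
Proof.
pose one := iota (unit_char HH R); have Cu := Cc_unit_char Het R Hcompact.
have l1 b : cmul one b = b.
  apply/eqP; rewrite -subr_eq0; apply/eqP/rn_eq0/eqP.
  rewrite -sqrf_eq0; apply/eqP.
  pose F b := cmul one b - b.
  have qF : quad (fun b => rn (F b) ^+ 2).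
    apply: (@quad_comp _ _ _ F _ (rn one + 1)) (quad_rn B).
    - by move=> u v; rewrite /F cmulDr opprD addrACA.
    - by rewrite addr_ge0 ?rn_ge0.
    - move=> u; apply: le_trans (rnD _ _) _; rewrite rnN mulrDl mul1r lerD2r.
      exact: rn_cmul.
  apply: (quad_closure0 qF _ (@iota_dense b)) => _ [f Cf <-].
  have [_ H1] := red_mul Hred Cu Cf.
  by rewrite /F -H1 conv_unit_char subrr rn0 expr0n.
have one_adj : cadj one = one.
  by rewrite -[RHS]cadjK -[in RHS](l1 (cadj one)) cadjM cadjK l1.
exists one => b; rewrite -[LHS]cadjK cadjM one_adj l1; exact: cadjK.
Qed.

End ReducedStates.

(** * Borel sets, square-integrable functions and Hilbert spaces *)

Section Borel.
Context (R : realType) (T : ptopologicalType).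

Lemma open_borel (U : set T) : open U -> measurable (U : set (borel T)).
Proof. by move=> oU; apply: sub_sigma_algebra. Qed.

Lemma closed_borel (C : set T) : closed C -> measurable (C : set (borel T)).
Proof.
move=> cC; rewrite -(setCK C); apply: measurableC; apply: open_borel.
by rewrite openC.
Qed.

Lemma borel_fun d (X : measurableType d) (D : set X) (f : X -> borel T) :
  (forall U : set T, open U -> measurable (D `&` f @^-1` U)) ->
  measurable_fun D f.
Proof.
move=> H; apply: (@measurability _ _ _ (borel T) D f (@open T)) => //.
by move=> _ [U oU <-]; exact: H.
Qed.

Lemma continuous_borel_fun (D : set T) (f : T -> R) : continuous f ->
  measurable (D : set (borel T)) ->
  @measurable_fun _ _ (borel T) _ D f.
Proof.
move=> cf mD; apply: (measurability _ (RGenOInfty.measurableE R)).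
move=> _ [_ [a ->] <-]; apply: measurableI => //; apply: open_borel.
by apply: open_comp => [? _|]; [exact: cf|exact: interval_open].
Qed.

End Borel.

Section L2Space.
Context d (T : measurableType d) (R : realType)
  (mu : {measure set T -> \bar R}) (D : set T) (mD : measurable D).
Implicit Types f g : T -> R[i].

Lemma measurable_abs2 f :
  measurable_fun D (fun t => complex.Re (f t)) ->
  measurable_fun D (fun t => complex.Im (f t)) ->
  measurable_fun D (fun t => (abs2 (f t))%:E).
Proof.
move=> mRe mIm; apply/measurable_EFinP; apply: measurable_funD;
exact: measurable_funX.
Qed.

Definition L2dist2 f g : R := fine (\int[mu]_(t in D) (abs2 (f t - g t))%:E).

Lemma L2funB f g : L2fun mu D f -> L2fun mu D g ->
  L2fun mu D (fun t => -1 * g t + f t).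
Proof.
move=> [mf1 mf2 If] [mg1 mg2 Ig].
have ReE t : complex.Re (-1 * g t + f t) = complex.Re (f t) - complex.Re (g t).
  by rewrite mulN1r addrC ReB.
have ImE t : complex.Im (-1 * g t + f t) = complex.Im (f t) - complex.Im (g t).
  by rewrite mulN1r addrC; case: (f t) (g t) => [? ?] [? ?].
have m1 : measurable_fun D (fun t => complex.Re (-1 * g t + f t)).
  by under eq_fun do rewrite ReE; exact: measurable_funB.
have m2 : measurable_fun D (fun t => complex.Im (-1 * g t + f t)).
  by under eq_fun do rewrite ImE; exact: measurable_funB.
split=> //.
have mf := measurable_abs2 mf1 mf2; have mg := measurable_abs2 mg1 mg2.
apply: (@le_lt_trans _ _
  (\int[mu]_(t in D) (2%:E * (abs2 (f t))%:E + 2%:E * (abs2 (g t))%:E))%E).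
  apply: ge0_le_integral => //.
  - by move=> t _; rewrite lee_fin abs2_ge0.
  - exact: measurable_abs2.
  - by apply: emeasurable_funD; apply: measurable_funeM.
  - move=> t _; rewrite -!EFinM -EFinD lee_fin /abs2 ReE ImE.
    case: (f t) (g t) => [a b] [c e] /=.
    by have := sqr_ge0 (a + c); have := sqr_ge0 (b + e); nra.
rewrite ge0_integralD //; last 4 first.
- by move=> t _; rewrite mule_ge0 // lee_fin abs2_ge0.
- exact: measurable_funeM.
- by move=> t _; rewrite mule_ge0 // lee_fin abs2_ge0.
- exact: measurable_funeM.
rewrite !ge0_integralZl_EFin //; try by move=> t _; rewrite lee_fin abs2_ge0.
by rewrite lte_add_pinfty // lte_mul_pinfty.
Qed.

Context (h : hilbert_space R) (cls : (T -> R[i]) -> h) (HL : is_L2 mu D cls).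

Lemma rn_cls f : L2fun mu D f ->
  rn (cls f) ^+ 2 = fine (\int[mu]_(t in D) (abs2 (f t))%:E).
Proof.
move=> Lf; rewrite -Re_rn2 hdot_norm (L2_dot HL) // /Cintegral /= /Rintegral.
by congr fine; apply: eq_integral => t _; rewrite conj_abs2.
Qed.

Lemma rn_clsB f g : L2fun mu D f -> L2fun mu D g ->
  rn (cls f - cls g) ^+ 2 = L2dist2 f g.
Proof.
move=> Lf Lg; have := L2_linear HL (-1) Lg Lf.
rewrite scaleN1r addrC => <-; rewrite rn_cls; last exact: L2funB.
rewrite /L2dist2; congr fine; apply: eq_integral => t _.
by rewrite mulN1r addrC.
Qed.

End L2Space.

Section Hilbert.
Context (R : realType) (h : hilbert_space R).
Implicit Types u v w : h.

Lemma hdotD u v w : hdot u (v + w) = hdot u v + hdot u w.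
Proof. by have := hdot_linear u 1 v w; rewrite scale1r mul1r. Qed.

Lemma hdotZ u k v : hdot u (k *: v) = k * hdot u v.
Proof.
by have := hdot_linear u k v 0; rewrite (add_fun0 (hdotD u)) !addr0.
Qed.

Lemma hdotB u v w : hdot u (v - w) = hdot u v - hdot u w.
Proof. exact: (add_funB (hdotD u)). Qed.

Lemma hdotvv u : hdot u u = ((rn u ^+ 2)%:C)%C.
Proof. by rewrite -hdot_norm normE -rmorphXn. Qed.

Lemma hdot_cs u v : abs2 (hdot u v) <= rn u ^+ 2 * rn v ^+ 2.
Proof.
have [u0|u0] := eqVneq (rn u) 0.
  rewrite (rn_eq0 u0) hdot_conj (add_fun0 (hdotD v)) conjC0 /abs2 /= expr0n.
  by rewrite addr0 rn0 expr0n mul0r.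
set k := hdot u v; pose s := (rn u ^+ 2)^-1.
have up : 0 < rn u ^+ 2 by rewrite lt_neqAle eq_sym sqrf_eq0 u0 sqr_ge0.
have uu : s * rn u ^+ 2 = 1 by rewrite mulVf // gt_eqF.
pose w := v - (((s%:C)%C * k) *: u).
have uw : hdot u w = 0.
  by rewrite /w hdotB hdotZ hdotvv mulrAC -rmorphM uu rmorph1 mul1r subrr.
have : complex.Re (hdot w w) = rn v ^+ 2 - s * abs2 k.
  have wu : hdot w u = 0 by rewrite hdot_conj uw conjC0.
  rewrite {2}/w hdotB hdotZ wu mulr0 subr0.
  rewrite hdot_conj /w hdotB hdotZ hdotvv [hdot v u]hdot_conj -/k.
  rewrite -mulrA (mulrC k) conj_abs2 -rmorphM -rmorphB.
  by rewrite conj_real.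
rewrite hdotvv /= => wE; have := sqr_ge0 (rn w); rewrite wE subr_ge0.
by rewrite -(ler_pM2l up) mulrA (mulrC _ s) uu mul1r.
Qed.

Lemma quad_hdot u : quad (fun v => abs2 (hdot u v)).
Proof. exact: quad_abs2 (hdotD u) (hdot_cs u). Qed.

End Hilbert.

(** * The measures on the fibres of an equivalence *)

Section Fibres.
Context (R : realType) (G0 : topologicalType) (G : ptopologicalType)
  (H0 H : topologicalType) (GG : groupoid G0 G) (HH : groupoid H0 H)
  (Z : ptopologicalType) (ZZ : equivalence GG HH Z)
  (nu : G0 -> {measure set (borel G) -> \bar R}) (Hnu : haar_system GG nu).
Implicit Types (x : H0) (z y : Z) (g : G) (a : H).

Lemma fibre_lact_inv g z x : rng GG g = lanchor ZZ z -> fibre ZZ x z ->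
  fibre ZZ x (lact ZZ (inv GG g) z).
Proof. by move=> gz zx; rewrite /fibre /= eq_ranchor ?src_inv. Qed.

Lemma lactK g z :
  src GG g = lanchor ZZ z -> lact ZZ (inv GG g) (lact ZZ g z) = z.
Proof.
by move=> gz; rewrite -lact_mul ?src_inv // inv_mul gz lact_unt.
Qed.

Lemma lactVK g z :
  rng GG g = lanchor ZZ z -> lact ZZ g (lact ZZ (inv GG g) z) = z.
Proof.
by move=> gz; rewrite -lact_mul ?rng_inv ?src_inv // mul_inv gz lact_unt.
Qed.

Lemma fibre_closed x : closed (fibre ZZ x).
Proof.
apply: (@preimage_closed _ _ (ranchor ZZ) [set x]) => [? _|].
  exact: ranchor_cont.
exact: (units_closed1 HH).
Qed.

Lemma fibre_borel x : measurable (fibre ZZ x : set (borel Z)).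
Proof. by apply: closed_borel; exact: fibre_closed. Qed.

(** Principality of the left action makes [g |-> g^-1 z] a homeomorphism onto
    the fibre, so preimages of compact sets are compact and have finite Haar
    measure. *)
Lemma fibre_measure_compact x (mu : {measure set (borel Z) -> \bar R})
    (K : set Z) : is_fibre_measure ZZ nu x mu -> compact K ->
  (mu (K `&` fibre ZZ x) < +oo)%E.
Proof.
move=> Hmu cK; have clK : closed K.
  exact: compact_closed (@eq_hausdorff _ _ _ _ _ _ _ ZZ) cK.
have cKx : compact (K `&` fibre ZZ x).
  by apply: compact_closedI => //; exact: fibre_closed.
have mK : measurable (K `&` fibre ZZ x : set (borel Z)).
  by apply: closed_borel; apply: closedI => //; exact: fibre_closed.
have [z zx] := eq_rsurj ZZ x; rewrite (Hmu z) //.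
have [[_ _ surj] [_ [k [kK ck]]]] := eq_lprincipal ZZ.
set S := [set g | _].
have cC : compact ([set z] `*` (K `&` fibre ZZ x)).
  by apply: compact_setX => //; exact: compact_set1.
have CB : [set z] `*` (K `&` fibre ZZ x) `<=`
    [set q : Z * Z | ranchor ZZ q.1 = ranchor ZZ q.2].
  by move=> [q1 q2] /= [-> [_ ->]].
have cS : compact (fst @` (k @` ([set z] `*` (K `&` fibre ZZ x)))).
  apply: continuous_compact.
    by apply: continuous_subspaceT => ?; exact: cvg_fst.
  by apply: continuous_compact cC; exact: continuous_subspaceW ck.
suff -> : S = fst @` (k @` ([set z] `*` (K `&` fibre ZZ x))).
  exact: haar_radon Hnu _ _ cS.
apply/seteqP; split=> [g [gz [Kg gx]]|_ [_ [[q1 q2] [/= -> [Kq qx]] <-] <-]].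
  exists (g, lact ZZ (inv GG g) z) => //.
  exists (z, lact ZZ (inv GG g) z) => //.
  have := kK (g, lact ZZ (inv GG g) z); rewrite /= lactVK // => -> //.
  by rewrite lanchor_act ?rng_inv ?src_inv.
have [|[g y] /= gy [gyz yq]] := surj (z, q2).
  by rewrite /= zx qx.
rewrite -gyz -yq; have := kK (g, y) gy; rewrite /= => -> /=.
rewrite /S /= -gyz lanchor_act //; split=> //.
by rewrite lactK // yq.
Qed.

Lemma Cc_L2 x (mu : {measure set (borel Z) -> \bar R}) (xi : Z -> R[i]) :
  is_fibre_measure ZZ nu x mu -> Cc xi -> L2fun mu (fibre ZZ x) xi.
Proof.
move=> Hmu [cxi Kxi]; have mD := fibre_borel x.
have cRe := continuous_Re cxi; have cIm := continuous_Im cxi.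
have m1 := continuous_borel_fun cRe mD; have m2 := continuous_borel_fun cIm mD.
split=> //; set K := closure _ in Kxi.
pose F := fun t => abs2 (xi t).
have cF : continuous F.
  have -> : F = (fun t => complex.Re (xi t) * complex.Re (xi t) +
      complex.Im (xi t) * complex.Im (xi t)) by [].
  by move=> t; apply: cvgD; apply: cvgM;
    [exact: cRe|exact: cRe|exact: cIm|exact: cIm].
have /compact_bounded[M0 [_ HM]] : compact (F @` K).
  by apply: continuous_compact Kxi; exact: continuous_subspaceT.
pose M := `|M0| + 1.
have M1 : 0 <= M by rewrite addr_ge0.
have FM t : K t -> F t <= M.
  move=> Kt; apply: le_trans (ler_norm _) _; apply: HM; last by exists t.
  by rewrite (le_lt_trans (ler_norm _)) // ltrDl.
have mK : measurable (K : set (borel Z)).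
  by apply: closed_borel; exact: closed_closure.
apply: (@le_lt_trans _ _
   (\int[mu]_(t in fibre ZZ x) (M%:E * (\1_K t)%:E))%E).
  apply: ge0_le_integral => //.
  - by move=> t _; rewrite lee_fin abs2_ge0.
  - exact: measurable_abs2.
  - by apply: measurable_funeM; apply/measurable_EFinP; exact: measurable_indic.
  - move=> t _; rewrite -EFinM lee_fin indicE; case: (boolP (t \in K)) => Kt.
      by rewrite mulr1 FM // -inE.
    rewrite mulr0 /F (_ : xi t = 0); first by rewrite /abs2 /= expr0n addr0.
    apply: contraNeq Kt => xt; rewrite inE; exact: subset_closure.
rewrite ge0_integralZl_EFin //; last first.
  by apply/measurable_EFinP; exact: measurable_indic.
rewrite integral_indic // lte_mul_pinfty //.
exact: fibre_measure_compact.
Qed.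

End Fibres.

(** * Translation between fibres *)

Section Translation.
Context (R : realType) (G0 : topologicalType) (G : ptopologicalType)
  (H0 H : topologicalType) (GG : groupoid G0 G) (HH : groupoid H0 H)
  (Z : ptopologicalType) (ZZ : equivalence GG HH Z)
  (nu : G0 -> {measure set (borel G) -> \bar R})
  (mu : H0 -> {measure set (borel Z) -> \bar R})
  (Hmu : forall x, is_fibre_measure ZZ nu x (mu x)).
Implicit Types (x : H0) (z y : Z) (g : G) (a : H).

Lemma ract_borel a :
  @measurable_fun _ _ (borel Z) (borel Z) (fibre ZZ (rng HH a)) (ract ZZ ^~ a).
Proof.
apply: borel_fun => U oU.
have /continuousP/(_ _ oU)/open_subspaceP[W oW WE] := @ract_cont _ _ _ _ ZZ.
have oV : open [set y | W (y, a)].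
  apply: (@open_comp _ _ (fun y => (y, a)) W) => // y _.
  by apply: cvg_pair; [exact: cvg_id|exact: cvg_cst].
have -> : fibre ZZ (rng HH a) `&` (ract ZZ ^~ a) @^-1` U =
          fibre ZZ (rng HH a) `&` [set y | W (y, a)].
  apply/seteqP; split=> y [ya Uy]; split=> //.
    have : [set p | U (ract ZZ p.1 p.2)] `&`
      [set p : Z * H | ranchor ZZ p.1 = rng HH p.2] `<=` W.
      by rewrite -WE => p [].
    by apply; split.
  have : W `&` [set p : Z * H | ranchor ZZ p.1 = rng HH p.2] `<=`
     [set p | U (ract ZZ p.1 p.2)] by rewrite WE => p [].
  by move=> /(_ (y, a)); apply; split.
by apply: measurableI; [exact: fibre_borel|exact: open_borel].
Qed.

Lemma measurable_ract a d (Y : measurableType d) (F : borel Z -> Y) :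
  measurable_fun (fibre ZZ (src HH a) : set (borel Z)) F ->
  @measurable_fun _ _ (borel Z) Y (fibre ZZ (rng HH a))
    (fun y => F (ract ZZ y a)).
Proof.
move=> mF; have mD := fibre_borel ZZ (src HH a).
apply: (@measurable_comp _ _ _ (borel Z) (borel Z) Y _ F _
  (ract ZZ ^~ a : borel Z -> borel Z) mD _ mF).
  by move=> _ [y yx <-]; rewrite /fibre /= ranchor_act.
exact: ract_borel.
Qed.

Lemma fibre_null x : mu x (~` fibre ZZ x) = 0%E.
Proof.
have [z zx] := eq_rsurj ZZ x; rewrite (Hmu zx); last first.
  by apply: measurableC; exact: fibre_borel.
rewrite [X in nu _ X](_ : _ = set0) ?measure0 //.
by apply/seteqP; split=> // g [gz []]; exact: fibre_lact_inv.
Qed.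

(** Right translation by [a] maps the measure on one fibre to that on the
    other, because it commutes with the left action defining both measures. *)
Lemma integral_ract a (F : Z -> \bar R) :
  @measurable_fun _ _ (borel Z) _ (fibre ZZ (src HH a)) F ->
  (forall y, 0 <= F y)%E ->
  (\int[mu (src HH a)]_(y in fibre ZZ (src HH a)) F y =
   \int[mu (rng HH a)]_(y in fibre ZZ (rng HH a)) F (ract ZZ y a))%E.
Proof.
move=> mF F0; set D := fibre ZZ (src HH a); set D' := fibre ZZ (rng HH a).
have mD : measurable (D : set (borel Z)) by exact: fibre_borel.
have mD' : measurable (D' : set (borel Z)) by exact: fibre_borel.
(* The translation is only continuous on the fibre, so it is extended by a
   constant; the added preimages are null sets. *)
pose phi : borel Z -> borel Z := (ract ZZ ^~ a : borel Z -> borel Z) \_ D'.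
have mphi : measurable_fun setT phi.
  by apply/(measurable_restrictT _ mD'); exact: ract_borel.
have phiE y : D' y -> phi y = ract ZZ y a.
  by move=> yD; rewrite /phi patchE mem_set.
have phiD y : D' y -> D (phi y).
  by move=> yD; rewrite phiE // /D /fibre /= ranchor_act.
pose M := measure_function_pushforward__canonical__measure_function_Measure
  (mu (rng HH a)) mphi.
rewrite (@eq_measure_integral _ (borel Z) R D M) => [|A mA AD]; last first.
  have [z zx] := eq_rsurj ZZ (rng HH a).
  have za : fibre ZZ (src HH a) (ract ZZ z a) by rewrite /fibre /= ranchor_act.
  rewrite (Hmu za) //= /pushforward (Hmu zx); last first.
    by rewrite -[X in measurable X]setTI; exact: (mphi).
  rewrite eq_lanchor //; congr (nu _ _); apply/seteqP.
  have act g : rng GG g = lanchor ZZ z ->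
      lact ZZ (inv GG g) (ract ZZ z a) = phi (lact ZZ (inv GG g) z).
    move=> gz; rewrite phiE; last exact: fibre_lact_inv.
    by rewrite eq_commute ?src_inv.
  by split=> g [gz Ag]; split=> //; move: Ag; rewrite /= act.
rewrite ge0_integral_pushforward //.
have mphiD : measurable (phi @^-1` D).
  by rewrite -[X in measurable X]setTI; exact: (mphi).
have mFphi : measurable_fun (phi @^-1` D) (F \o phi).
  apply: (measurable_comp mD) => //; first by move=> _ [y yD <-].
  exact: measurable_funTS.
rewrite (@ge0_negligible_integral _ _ _ (mu (rng HH a)) _ (~` D')) //;
  last 3 first.
- exact: measurableC.
- by move=> y _ /=.
- exact: fibre_null.
have -> : phi @^-1` D `\` ~` D' = D'.
  apply/seteqP; split=> y; first by move=> [_ /contrapT].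
  by move=> yD; split; [exact: phiD|apply].
by apply: eq_integral => y; rewrite inE => yD /=; rewrite phiE.
Qed.

Context (h : H0 -> hilbert_space R)
  (cls : forall x, (borel Z -> R[i]) -> h x)
  (HL : forall x, is_L2 (mu x) (fibre ZZ x) (@cls x)).

Lemma L2fun_ract a (f : Z -> R[i]) :
  L2fun (mu (src HH a)) (fibre ZZ (src HH a)) f ->
  L2fun (mu (rng HH a)) (fibre ZZ (rng HH a)) (fun y => f (ract ZZ y a)).
Proof.
move=> [m1 m2 I]; have mD := fibre_borel ZZ (src HH a).
split.
- exact: (measurable_ract m1).
- exact: (measurable_ract m2).
rewrite -(integral_ract (F := fun y => (abs2 (f y))%:E)) //.
  exact: measurable_abs2.
by move=> y; rewrite lee_fin abs2_ge0.
Qed.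

Lemma rn_cls_ract a (f f' : Z -> R[i]) :
  L2fun (mu (src HH a)) (fibre ZZ (src HH a)) f ->
  L2fun (mu (src HH a)) (fibre ZZ (src HH a)) f' ->
  rn (cls (rng HH a) (fun y => f (ract ZZ y a)) -
      cls (rng HH a) (fun y => f' (ract ZZ y a))) =
  rn (cls (src HH a) f - cls (src HH a) f').
Proof.
move=> Lf Lf'; apply/eqP; rewrite -(eqrXn2 (n := 2)) ?rn_ge0 //; apply/eqP.
have mD x := fibre_borel ZZ x.
rewrite (rn_clsB (mD _) (HL _)); try exact: L2fun_ract.
rewrite (rn_clsB (mD _) (HL _)) // /L2dist2; congr fine.
rewrite (integral_ract (F := fun y => (abs2 (f y - f' y))%:E)) //.
  have [m1 m2 _] := L2funB (mD _) Lf Lf'.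
  have := measurable_abs2 m1 m2.
  by under eq_fun do rewrite mulN1r addrC.
by move=> y; rewrite lee_fin abs2_ge0.
Qed.

End Translation.

(** * Generated submodules *)

Section LinSpan.
Context (R : realType) (V : normedModType R[i]).
Implicit Types (S : set V) (u v : V).

Lemma lin_span_lin S k u v :
  lin_span S u -> lin_span S v -> lin_span S (k *: u + v).
Proof.
move=> [n [c [w [Sw ->]]]] [m [d [t [St ->]]]]; exists (n + m)%N.
exists (fun i =>
  match fintype.split i with inl i => k * c i | inr i => d i end).
exists (fun i => match fintype.split i with inl i => w i | inr i => t i end).
split=> [i|]; first by case: (fintype.split i).
rewrite big_split_ord /= scaler_sumr; congr (_ + _); apply: eq_bigr => i _.
  by rewrite -[lshift _ _]/(unsplit (inl i)) unsplitK scalerA.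
by rewrite -[rshift _ _]/(unsplit (inr i)) unsplitK.
Qed.

Lemma mem_lin_span S v : S v -> lin_span S v.
Proof.
move=> Sv; exists 1%N, (fun=> 1), (fun=> v); split=> //.
by rewrite big_ord1 scale1r.
Qed.

Lemma closure_lin S k u v :
  (forall k u v, S u -> S v -> S (k *: u + v)) ->
  closure S u -> closure S v -> closure S (k *: u + v).
Proof.
move=> Slin /closure_rnP Su /closure_rnP Sv; apply/closure_rnP => r r0.
pose m := complex.Re `|k| + 1.
have k0 : 0 <= complex.Re `|k| by exact: (@rn_ge0 _ (R[i]^o) k).
have m0 : 0 < m by rewrite ltr_wpDl.
have r1 : 0 < r / 2 / m by rewrite !divr_gt0.
have r2 : 0 < r / 2 by rewrite divr_gt0.
have [s Ss /ltW us] := Su _ r1; have [t St vt] := Sv _ r2.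
exists (k *: s + t); first exact: Slin.
have -> : k *: u + v - (k *: s + t) = k *: (u - s) + (v - t).
  by rewrite scalerBr opprD addrACA.
apply: le_lt_trans (rnD _ _) _; rewrite rnZ.
have -> : r = m * (r / 2 / m) + r / 2 by field; apply: lt0r_neq0.
by apply: ler_ltD => //; apply: ler_pM; rewrite ?rn_ge0 // lerDl.
Qed.

End LinSpan.

Section GeneratedSubmodule.
Context (R : realType) (B : cstar_algebra R) (X : Type)
  (omega : X -> B -> R[i]) (Hom : norming_states omega) (V : cstar_module B)
  (J : choiceType) (e : J -> V).

Lemma generated_lin k u v :
  generated_submodule e u -> generated_submodule e v ->
  generated_submodule e (k *: u + v).
Proof. by apply: closure_lin => *; exact: lin_span_lin. Qed.

Lemma generated_act v b :
  generated_submodule e v -> generated_submodule e (mact v b).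
Proof.
move=> /closure_rnP Ev; apply/closure_rnP => r r0.
have m0 : 0 < rn b + 1 by rewrite ltr_wpDl ?rn_ge0.
have r1 : 0 < r / (rn b + 1) by rewrite divr_gt0.
have [s [n [c [w [Sw sE]]]] vs] := Ev _ r1.
exists (mact s b); last first.
  rewrite -mactBl; apply: le_lt_trans (rn_mact Hom _ _) _.
  move: vs; rewrite ltr_pdivlMr //; have := rn_ge0 (v - s).
  by have := rn_ge0 b; nra.
exists n, c, (fun i => mact (w i) b); split=> [i|].
  by have [j [b' ->]] := Sw i; exists j, (cmul b' b); rewrite mactA.
rewrite sE (add_fun_sum (mactDl b)); apply: eq_bigr => i _.
by rewrite mactZl.
Qed.

Lemma generated_gen one j : (forall b : B, cmul b one = b) ->
  generated_submodule e (e j).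
Proof.
move=> Hone; apply: subset_closure; apply: mem_lin_span; exists j, one.
apply/esym/eqP; rewrite -subr_eq0; apply/eqP/rn_eq0/eqP.
rewrite -sqrf_eq0 -rn_mdotvv; set w := _ - _.
by rewrite {2}/w mdotBr mdot_act Hone subrr rn0.
Qed.

End GeneratedSubmodule.

(** * Localised frames *)

Section Localisations.
Context (R : realType)
    (G0 : topologicalType) (G : ptopologicalType) (H0 H : topologicalType)
    (Z : ptopologicalType)
    (GG : groupoid G0 G) (HH : groupoid H0 H)
    (Het : etale HH) (Hcompact : compact [set: H0])
    (nu : G0 -> {measure set (borel G) -> \bar R}) (Hnu : haar_system GG nu)
    (ZZ : equivalence GG HH Z)
    (B : cstar_algebra R) (iota : (H -> R[i]) -> B)
    (Hred : is_reduced_cstar HH iota)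
    (L2Z : cstar_module B) (kappa : (Z -> R[i]) -> L2Z)
    (HL2Z : is_L2Z ZZ nu iota kappa)
    (omega : H0 -> B -> R[i])
    (mu : H0 -> {measure set (borel Z) -> \bar R})
    (h : H0 -> hilbert_space R)
    (cls : forall x : H0, (borel Z -> R[i]) -> h x)
    (loc : forall x : H0, L2Z -> h x)
    (Hloc : forall x : H0,
      is_localisation ZZ nu iota kappa x (omega x) (mu x) (cls x) (loc x)).
Implicit Types (x : H0) (e v : L2Z) (a : H).

Lemma omega_norming : norming_states omega.
Proof.
apply: (reduced_norming Het Hred) => x; first exact: loc_state (Hloc x).
by move=> f; exact: (loc_state_Cc (Hloc x)).
Qed.

Lemma locB x e v : loc x (e - v) = loc x e - loc x v.
Proof.
have := loc_linear (Hloc x) (-1) v e; rewrite !scaleN1r addrC => ->.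
by rewrite addrC.
Qed.

Lemma rn_loc x v : rn (loc x v) ^+ 2 = form omega x v v.
Proof. by rewrite -Re_rn2 hdot_norm (loc_dot (Hloc x)). Qed.

Lemma rn_loc_le x v : rn (loc x v) <= rn v.
Proof.
apply: le_sqr_rn; rewrite ?rn_ge0 // rn_loc.
by apply: le_trans (form_le omega_norming x v) _; rewrite mul1r.
Qed.

Local Notation tr a e := (translate ZZ mu cls loc (rng HH a) e a).

Lemma translateP e a : exists f : Z -> R[i],
  [/\ L2fun (mu (src HH a)) (fibre ZZ (src HH a)) f,
      cls (src HH a) f = loc (src HH a) e &
      tr a e = cls (rng HH a) (fun y => f (ract ZZ y a))].
Proof.
pose P := [set f : Z -> R[i] | L2fun (mu (src HH a)) (fibre ZZ (src HH a)) f /\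
   cls (src HH a) f = loc (src HH a) e].
have [f Lf fE] := L2_surj (loc_L2 (Hloc (src HH a))) (loc (src HH a) e).
have [L1 E1] : P (xget 0 P) by apply: (xgetPex 0); exists f.
by exists (xget 0 P).
Qed.

Let Hmu x : is_fibre_measure ZZ nu x (mu x) := loc_measure (Hloc x).
Let HL x : is_L2 (mu x) (fibre ZZ x) (@cls x) := loc_L2 (Hloc x).

Lemma rn_translateB e v a :
  rn (tr a e - tr a v) = rn (loc (src HH a) e - loc (src HH a) v).
Proof.
have [f [Lf fE ->]] := translateP e a; have [g [Lg gE ->]] := translateP v a.
by rewrite (rn_cls_ract Hmu HL Lf Lg) fE gE.
Qed.

Definition inv_bump a (g : H -> R[i]) := [/\ Cc g, g (inv HH a) = 1 &
  forall b, src HH b = src HH (inv HH a) -> b <> inv HH a -> g b = 0].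

(** At [y] in the fibre only [a] contributes to the sum defining the action of
    [g] on [xi], which therefore takes the value [xi (y a)]. *)
Lemma translate_Cc (xi : Z -> R[i]) a g : inv_bump a g -> Cc xi ->
  tr a (kappa xi) = loc (rng HH a) (mact (kappa xi) (iota g)).
Proof.
move=> [Cg ga g0] Cxi; have [CZ <-] := L2Z_act HL2Z Cxi Cg.
rewrite (loc_Cc (Hloc _)) //.
have [f [Lf fE ->]] := translateP (kappa xi) a.
have Lxi := Cc_L2 Hnu (@Hmu (src HH a)) Cxi.
have LZ := Cc_L2 Hnu (@Hmu (rng HH a)) CZ.
have Lxi' := L2fun_ract Hmu Lxi.
have -> : cls (rng HH a) (fun y => f (ract ZZ y a)) =
    cls (rng HH a) (fun y => xi (ract ZZ y a)).
  apply/eqP; rewrite -subr_eq0; apply/eqP/rn_eq0.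
  by rewrite (rn_cls_ract Hmu HL Lf Lxi) fE (loc_Cc (Hloc _)) // subrr rn0.
apply/eqP; rewrite -subr_eq0; apply/eqP/rn_eq0/eqP.
rewrite -sqrf_eq0 (rn_clsB (fibre_borel ZZ _) (HL _)) // /L2dist2.
rewrite [X in fine X](_ : _ = 0%E) //.
rewrite -[RHS](integral0 (mu (rng HH a)) (fibre ZZ (rng HH a))).
apply: eq_integral => y; rewrite inE /fibre /= => ya.
rewrite /Zact (fsbig_finsupp (A := [fset a]%fset)).
- by rewrite big_seq_fset1 ga mulr1 subrr /abs2 /= expr0n addr0.
- by move=> b /=; rewrite inE => /eqP ->.
move=> b /= ba; rewrite inE => /eqP nba.
rewrite g0 ?mulr0 // ?src_inv ?ba // => /inv_inj.
exact: nba.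
Qed.

(** By continuity the description of translates on [Cc] extends to the module:
    translating is right multiplication by a function that restricts to a point
    mass on the relevant fibre. *)
Lemma translateE e a g : inv_bump a g ->
  tr a e = loc (rng HH a) (mact e (iota g)).
Proof.
move=> Hg; apply/eqP; rewrite -subr_eq0; apply/eqP/rn_eq0/eqP.
rewrite eq_le rn_ge0 andbT; apply/ler_addgt0Pr => r r0; rewrite add0r.
have m0 : 0 < 1 + rn (iota g) by rewrite ltr_wpDr ?rn_ge0.
have ecl : closure (kappa @` [set xi | Cc xi]) e by rewrite (L2Z_dense HL2Z).
have r1 : 0 < r / (1 + rn (iota g)) by rewrite divr_gt0.
have [_ [xi Cxi <-] /ltW] := iffLR (closure_rnP _ _) ecl _ r1.
rewrite ler_pdivlMr // => h1.
rewrite -(subrKA (tr a (kappa xi))).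
apply: le_trans (rnD _ _) _; apply: le_trans h1; rewrite mulrDr mulr1.
apply: lerD; first by rewrite rn_translateB -locB; exact: rn_loc_le.
rewrite (translate_Cc Hg Cxi) -locB -mactBl; apply: le_trans (rn_loc_le _ _) _.
by rewrite (rnB e); exact: (rn_mact omega_norming).
Qed.

Lemma hdot_translate e v a g : inv_bump a g ->
  hdot (tr a e) (loc (rng HH a) v) =
  omega (rng HH a) (cmul (cadj (iota g)) (mdot e v)).
Proof.
by move=> Hg; rewrite (translateE e Hg) (loc_dot (Hloc _)) mdot_actl.
Qed.

Lemma inv_bump_ex : exists beta : H -> H -> R[i],
  (forall a, inv_bump a (beta (inv HH a))) /\
  forall a, [/\ Cc (beta a), beta a a = 1 &
     forall b, src HH b = src HH a -> b <> a -> beta a b = 0].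
Proof.
have [beta Hb] := choice (@src_bump _ _ HH Het R); exists beta; split=> // a.
by have [C b1 b0] := Hb (inv HH a); split.
Qed.

(** The coefficients of a localised vector against the translates of [e] are
    the coefficients of [(e | v)] in the orthonormal basis of the GNS space at
    [x]. *)
Lemma translate_parseval x e v :
  (\esum_(a in [set a | rng HH a = x])
     (abs2 (hdot (translate ZZ mu cls loc x e a) (loc x v)))%:E =
   (sq (omega x) (mdot e v))%:E)%E.
Proof.
have [beta [Hi Hb]] := inv_bump_ex.
have Hst x' := loc_state (Hloc x').
have HCc x' f (Cf : Cc f) := loc_state_Cc (Hloc x') Cf.
rewrite -(state_parseval Het Hred Hst HCc x Hb (mdot e v)).
rewrite [RHS](@reindex_esum _ _ _ [set a | rng HH a = x] _ (inv HH));
  last first.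
  split=> [a /= ax|a b _ _|b /= bx]; first by rewrite src_inv.
    exact: inv_inj.
  by exists (inv HH b); rewrite ?inv_invK //= rng_inv.
by apply: eq_esum => a /= <-; rewrite (hdot_translate e v (Hi a)).
Qed.

Lemma translates_parseval (J : choiceType) (e : J -> L2Z) x v :
  (\esum_(p in [set p : J * H | rng HH p.2 = x])
     (abs2 (hdot (translate ZZ mu cls loc x (e p.1) p.2) (loc x v)))%:E =
   \esum_(j in setT) (sq (omega x) (mdot (e j) v))%:E)%E.
Proof.
under [RHS]eq_esum do rewrite -translate_parseval.
rewrite (esum_esum (J := fun=> [set a | rng HH a = x])) => [|j a _ _];
  last first.
  by rewrite lee_fin abs2_ge0.
by congr esum; apply/seteqP; split=> p //= [].
Qed.

(** Tightness on the dense subspace of localised vectors of the submodule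
    extends to its closure. *)
Lemma tight_frame_parseval (J : choiceType) (e : J -> L2Z) x :
  tight_frame (closure (loc x @` generated_submodule e))
    [set p : J * H | rng HH p.2 = x]
    (fun p => translate ZZ mu cls loc x (e p.1) p.2) <->
  forall v, generated_submodule e v ->
    (\esum_(j in setT) (sq (omega x) (mdot (e j) v))%:E =
     (form omega x v v)%:E)%E.
Proof.
split=> [[_ tf] v Ev|pars].
  rewrite -translates_parseval tf; first by rewrite Re_rn2 rn_loc.
  by apply: subset_closure; exists v.
have [one Hone] := reduced_unit Het Hcompact Hred.
have [beta [Hi _]] := inv_bump_ex.
split=> [p /= px|psi Epsi].
  apply: subset_closure; move: px => <-; rewrite (translateE _ (Hi p.2)).
  exists (mact (e p.1) (iota (beta (inv HH p.2)))) => //.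
  by apply: (generated_act omega_norming); exact: generated_gen Hone.
rewrite Re_rn2.
apply: (parseval_closure (S := loc x @` generated_submodule e)
  (F := fun p psi => abs2 (hdot (translate ZZ mu cls loc x (e p.1) p.2) psi))
  _ (quad_rn (h x))) => //.
- by move=> p; exact: quad_hdot.
- move=> _ _ [u Eu <-] [v Ev <-]; exists (u - v); last exact: locB.
  by rewrite addrC -scaleN1r; exact: generated_lin.
- by move=> _ [v Ev <-]; rewrite translates_parseval pars // rn_loc.
Qed.

End Localisations.

Theorem theorem3p4 (R : realType)
    (G0 : topologicalType) (G : ptopologicalType) (H0 H : topologicalType)
    (Z : ptopologicalType)
    (GG : groupoid G0 G) (HH : groupoid H0 H)
    (Het : etale HH) (Hcompact : compact [set: H0])
    (nu : G0 -> {measure set (borel G) -> \bar R}) (Hnu : haar_system GG nu)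
    (ZZ : equivalence GG HH Z)
    (B : cstar_algebra R) (iota : (H -> R[i]) -> B)
    (Hred : is_reduced_cstar HH iota)
    (L2Z : cstar_module B) (kappa : (Z -> R[i]) -> L2Z)
    (HL2Z : is_L2Z ZZ nu iota kappa)
    (omega : H0 -> B -> R[i])
    (mu : H0 -> {measure set (borel Z) -> \bar R})
    (h : H0 -> hilbert_space R)
    (cls : forall x : H0, (borel Z -> R[i]) -> h x)
    (loc : forall x : H0, L2Z -> h x)
    (Hloc : forall x : H0,
      is_localisation ZZ nu iota kappa x (omega x) (mu x) (cls x) (loc x))
    (J : countType) (e : J -> L2Z) :
  let E : set L2Z := generated_submodule e in
  is_frame E e <->
  ((forall xi, E xi -> in_ell2 (fun j => mdot (e j) xi)) /\
   (forall x : H0,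
      tight_frame (closure (loc x @` E))
        [set p : J * H | rng HH p.2 = x]
        (fun p => translate ZZ mu cls loc x (e p.1) p.2))).
Proof.
move=> E; have Hom := omega_norming Het Hred Hloc.
have [one Hone] := reduced_unit Het Hcompact Hred.
have Ee j : E (e j) by exact: generated_gen Hone.
have Elin k u v : E u -> E v -> E (k *: u + v) by exact: generated_lin.
have Eact v b : E v -> E (mact v b) by exact: (generated_act Hom).
have fp := frame_parseval Hom Elin Eact Ee.
have tp := tight_frame_parseval Het Hcompact Hnu Hred HL2Z Hloc e.
split=> [/fp[ell pars]|[ell tf]].
  by split=> // x; apply/tp => v Ev; exact: pars.
apply/fp; split=> // x v Ev.
by have /tp := tf x; exact.
Qed.
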